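(* Let $B_1,\dots,B_N$ be bubbles with colors $\{1,2,3\}$ (arbitrary, not necessarily planar) and $n_1,\dots,n_N$ positive integers. Suppose that $B_i$ is planar for some $i\in\{1,\dots,N\}$, and let $G\in\mathcal{G}^{\max}_{n_1,\dots,n_N}(B_1,\dots,B_N)$. Then each of the $n_i$ copies of $B_i$ in $G$ satisfies the maximal 2-cut property.
   Context: Dimension $d=3$. A colored graph (with colors $\{0,1,2,3\}$) is a finite connected bipartite graph (vertices black and white, every edge joins a black and a white vertex, multiple edges allowed) in which each edge carries a color in $\{0,1,2,3\}$ and every vertex has exactly one incident edge of each color. A bubble is a finite connected bipartite graph whose edges carry colors in $\{1,2,3\}$, each vertex having exactly one incident edge of each color. Removing the edges of color 0 from a colored graph $G$ leaves a disjoint union of bubbles, called the bubbles of $G$. $\mathcal{G}_{n_1,\dots,n_N}(B_1,\dots,B_N)$ is the set of colored graphs whose bubbles are exactly $n_j$ copies of $B_j$ for each $j$ (isomorphism preserving colors and bipartition). A bicolored cycle with colors $\{a,b\}$ is a connected component of the subgraph consisting of all vertices and the edges of colors $a,b$ (a cycle alternating $a$ and $b$). $C_0(G)$ is the total number of bicolored cycles of $G$ with colors $\{0,c\}$, $c=1,2,3$, and $\mathcal{G}^{\max}_{n_1,\dots,n_N}(B_1,\dots,B_N)$ is the set of graphs in $\mathcal{G}_{n_1,\dots,n_N}(B_1,\dots,B_N)$ maximizing $C_0$. A bubble $B$ is planar if its canonical embedding as a combinatorial map (cyclic order of incident colors $(1,2,3)$ counterclockwise around white vertices and $(1,3,2)$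 around black vertices; its faces are exactly the bicolored cycles) has genus $0$. A pairing of a bubble $B$ is a perfect matching $\pi$ between its black and white vertices; adding an edge of color 0 between $v$ and $\pi(v)$ for every $v$ gives a colored graph with the single bubble $B$; the set of such graphs is $\mathcal{G}_1(B)$ and $\mathcal{G}^{\max}_1(B)$ denotes the pairings maximizing $C_0$. A $k$-edge-cut is a set of $k$ edges whose removal disconnects the graph while removing any proper subset does not; it is incident on a bubble $B\subset G$ if all its edges have color 0 and each has exactly one endpoint in $B$. A bubble $B\subset G$ satisfies the maximal 2-cut property if there is a pairing $\pi\in\mathcal{G}^{\max}_1(B)$ such that for every vertex $v$ of $B$, either $v$ and $\pi(v)$ are joined by an edge of color 0 in $G$, or the two edges of color 0 of $G$ incident to $v$ and to $\pi(v)$ form a 2-edge-cut incident on $B$. *)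

(* Defs.v *)
From mathcomp Require Import all_boot.

Set Implicit Arguments.
Unset Strict Implicit.
Unset Printing Implicit Defensive.

(* Edge-colored bipartite multigraphs in which every vertex has exactly one
   incident edge of each of the n colors; [nb c v] is the other endpoint of the
   edge of color c at v.  Connectedness is stated separately. *)
Record cgraph (n : nat) := CGraph {
  vert :> finType;
  white : pred vert;
  nb : 'I_n -> vert -> vert;
  nbK : forall c, involutive (nb c);
  white_nb : forall c v, white (nb c v) = ~~ white v }.

Arguments white {n c} : rename.
Arguments nb {n} c _ _ : rename.

Section Graph.
Variables (n : nat) (G : cgraph n).

(* An edge is encoded as (its color, its white endpoint). *)
Definition edges : {set 'I_n * G} := [set e | white e.2].

Definition edge_at (c : 'I_n) (v : G) : 'I_n * G :=
  (c, if white v then v else nb G c v).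

(* Adjacency in the subgraph with all vertices of G and the edges in E. *)
Definition span (E : {set 'I_n * G}) : rel G :=
  [rel x y | [exists c, (edge_at c x \in E) && (nb G c x == y)]].

Definition connected_by (E : {set 'I_n * G}) : bool :=
  (0 < #|G|) && [forall x : G, forall y : G, connect (span E) x y].

Definition gconnected : bool := connected_by edges.

Definition bicycles (a b : 'I_n) : nat :=
  n_comp (span [set e in edges | e.1 \in [set a; b]]) predT.

Definition edge_cut (k : nat) (F : {set 'I_n * G}) : Prop :=
  [/\ F \subset edges, #|F| = k, ~~ connected_by (edges :\: F)
    & forall F' : {set 'I_n * G}, F' \proper F -> connected_by (edges :\: F')].

End Graph.

Arguments edges {n} G.
Arguments gconnected {n} G.
Arguments bicycles {n} G a b.

Definition iso (n : nat) (G H : cgraph n) : Prop :=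
  exists f : G -> H, [/\ bijective f, forall v, white (f v) = white v
    & forall c v, f (nb G c v) = nb H c (f v)].

(* In a [cgraph 4] the colors are 0,1,2,3.  In a [cgraph 3] the index c : 'I_3
   stands for the color c+1, i.e. for [lift ord0 c : 'I_4]. *)
Definition is_bubble (B : cgraph 3) : bool := gconnected B.

Definition is_colored_graph (G : cgraph 4) : bool := gconnected G.

Definition C0 (G : cgraph 4) : nat :=
  \sum_(c < 3) bicycles G ord0 (lift ord0 c).

Section BubblesOf.
Variable G : cgraph 4.

Definition bubble_rel : rel G := span [set e in edges G | e.1 != ord0].

Definition bubble_set (v : G) : {set G} := [set u | connect bubble_rel v u].

Definition bubble_sets : {set {set G}} := [set bubble_set v | v : G].

Variable v : G.

Lemma bubble_set_nb (c : 'I_3) (u : G) :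
  u \in bubble_set v -> nb G (lift ord0 c) u \in bubble_set v.
Proof.
rewrite !inE => /connect_trans; apply; apply: connect1.
apply/existsP; exists (lift ord0 c); rewrite eqxx andbT !inE /=.
by case: ifP => wu; rewrite ?white_nb wu.
Qed.

Definition bubble_nb (c : 'I_3) (u : {u | u \in bubble_set v}) :
    {u | u \in bubble_set v} :=
  exist _ (nb G (lift ord0 c) (val u)) (bubble_set_nb c (valP u)).

Lemma bubble_nbK c : involutive (bubble_nb c).
Proof. by move=> u; apply: val_inj; rewrite /= nbK. Qed.

Lemma bubble_white_nb c (u : {u | u \in bubble_set v}) :
  white (val (bubble_nb c u)) = ~~ white (val u).
Proof. exact: white_nb. Qed.

(* The bubble of G containing v. *)
Definition bubble_at : cgraph 3 :=
  @CGraph 3 {u | u \in bubble_set v} (fun u => white (val u))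
    bubble_nb bubble_nbK bubble_white_nb.

End BubblesOf.

(* The B j need not be pairwise non-isomorphic, hence the labelling t. *)
Definition in_G (N : nat) (B : 'I_N -> cgraph 3) (m : 'I_N -> nat)
    (G : cgraph 4) : Prop :=
  is_colored_graph G /\
  exists t : {set G} -> 'I_N,
    (forall v : G, iso (bubble_at v) (B (t (bubble_set v)))) /\
    (forall j, #|[set S in bubble_sets G | t S == j]| = m j).

Definition in_Gmax (N : nat) (B : 'I_N -> cgraph 3) (m : 'I_N -> nat)
    (G : cgraph 4) : Prop :=
  in_G B m G /\ forall H : cgraph 4, in_G B m H -> C0 H <= C0 G.

Section Planarity.
Variable B : cgraph 3.

(* Canonical embedding: the dart (v, c) is the half-edge of color c at v. *)
Definition map_node (d : B * 'I_3) : B * 'I_3 :=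
  (d.1, if white d.1 then ordS d.2 else ord_pred d.2).

Definition map_edge (d : B * 'I_3) : B * 'I_3 := (nb B d.2 d.1, d.2).

Definition map_face (d : B * 'I_3) : B * 'I_3 := map_node (map_edge d).

(* Euler's formula V - E + F = 2 - 2g (B connected). *)
Definition has_genus (g : nat) : Prop :=
  fcard map_node predT + fcard map_face predT + g.*2
  = fcard map_edge predT + 2.

Definition planar : Prop := has_genus 0.

End Planarity.

Record pairing (B : cgraph 3) := Pairing {
  pfun :> B -> B;
  pfunK : involutive pfun;
  white_pfun : forall v, white (pfun v) = ~~ white v }.

Section Closure.
Variables (B : cgraph 3) (p : pairing B).

Definition closure_nb (c : 'I_4) : B -> B :=
  if unlift ord0 c is Some c' then nb B c' else p.

Lemma closure_nbK c : involutive (closure_nb c).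
Proof.
by rewrite /closure_nb; case: unliftP => [c'|] _; [apply: nbK | apply: pfunK].
Qed.

Lemma closure_white_nb c v : white (closure_nb c v) = ~~ white v.
Proof.
by rewrite /closure_nb; case: unliftP => [c'|] _; rewrite ?white_nb ?white_pfun.
Qed.

Definition pairing_graph : cgraph 4 :=
  @CGraph 4 B white closure_nb closure_nbK closure_white_nb.

End Closure.

Definition max_pairing (B : cgraph 3) (p : pairing B) : Prop :=
  forall q : pairing B, C0 (pairing_graph q) <= C0 (pairing_graph p).

Definition incident_on (G : cgraph 4) (F : {set 'I_4 * G}) (S : {set G}) : Prop :=
  forall e, e \in F ->
    e.1 = ord0 /\ (e.2 \in S) (+) (nb G e.1 e.2 \in S).

Definition maximal_2cut (G : cgraph 4) (v : G) : Prop :=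
  exists p : pairing (bubble_at v), max_pairing p /\
    forall u : bubble_at v,
      nb G ord0 (val u) = val (p u) \/
      let F := [set edge_at ord0 (val u); edge_at ord0 (val (p u))] in
      edge_cut 2 F /\ incident_on F (bubble_set v).

(* Main.v *)
(* Fix a planar bubble B in a maximal G.  Following the bicolored cycles of
   colors 0 and c outside B from one vertex of B to the next gives, for each
   color c, a perfect matching beta_c of the vertices of B; write b_c for the
   matching given by the edges of color c in B.  All matchings are encoded as
   permutations, so that numbers of bicolored cycles are numbers of cycles of
   quotients.

   The key inequality (planar_gap) holds for any planar b and any beta: there
   are matchings s and t with
     sum_c cyc(b_c, beta_c) + 3 K <= sum_c cyc(b_c, s) + sum_c cyc(beta_c, t),
   where K is the number of components of the graph formed by the beta_c and
   t, and the inequality is strict unless all the beta_c coincide.  It is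
   proved by contracting pairs of vertices u, w joined by an edge of B: this
   keeps B planar and, by Euler's relation, B always has a face of length 2 or
   4 along which no loss occurs.

   If the beta_c did not coincide, closing B with s, closing its exterior with
   t, and reconnecting the resulting pieces (each reconnection costs 3 cycles)
   would increase C_0.  So all the beta_c equal one pairing rho of B; the same
   surgery shows that rho is maximal and that the components of the exterior
   meet B in one pair {u, rho(u)} each, whence the 2-edge-cuts. *)

Require Import Defs.
From mathcomp Require Import all_boot.
From mathcomp Require Import all_fingroup.
From mathcomp Require Import zify.

Set Implicit Arguments.
Unset Strict Implicit.
Unset Printing Implicit Defensive.

Import GroupScope.

(** * Components of graphs drawn by permutations *)

Section Images.
Variables (T : finType) (A : {set T}).

Lemma leq_card_imset_ker (U V : finType) (f : T -> U) (g : T -> V) :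
  {in A &, forall x y, g x = g y -> f x = f y} -> #|f @: A| <= #|g @: A|.
Proof.
move=> fg; case: (set_0Vmem A) => [->|[x0 Ax0]]; first by rewrite !imset0 !cards0.
(* [h] recovers [f x] from [g x] through a chosen preimage in [A]; the default [x0] is reached only
   for values outside [g @: A]. *)
pose h v := f (odflt x0 [pick x in A | g x == v]).
apply: leq_trans (leq_imset_card h _); apply: subset_leq_card.
apply/subsetP=> _ /imsetP[x Ax ->]; apply/imsetP; exists (g x).
  exact: imset_f.
rewrite /h; case: pickP => [y /andP[Ay /eqP gy]|/(_ x)] /=; last by rewrite Ax eqxx.
exact: fg.
Qed.

Lemma eq_card_imset_ker (U V : finType) (f : T -> U) (g : T -> V) :
  {in A &, forall x y, f x = f y <-> g x = g y} -> #|f @: A| = #|g @: A|.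
Proof.
by move=> fg; apply/eqP; rewrite eqn_leq !leq_card_imset_ker // => x y Ax Ay /fg->.
Qed.

End Images.

Section Classes.
Variable T : finType.
Implicit Types (e : rel T) (x y z : T).

Definition nclass e := #|root e @: [set: T]|.

Lemma n_comp_imset_root e (A : {set T}) : connect_sym e ->
  (forall x, exists2 y, y \in A & connect e x y) ->
  n_comp e predT = #|root e @: A|.
Proof.
move=> eC cA; rewrite /n_comp_mem; apply: eq_card => x; rewrite !inE andbT.
apply/eqP/imsetP => [<-|[y _ ->]]; last exact: root_root.
by have [y Ay /(rootP eC)->] := cA x; exists y.
Qed.

Definition link e z1 z2 : rel T :=
  [rel x y | [|| e x y, (x == z1) && (y == z2) | (x == z2) && (y == z1)]].

Lemma link_sym e z1 z2 : symmetric e -> symmetric (link e z1 z2).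
Proof.
by move=> es x y; rewrite /link /= es; congr orb; rewrite orbC andbC [X in _ || X]andbC.
Qed.

Lemma connect_root_eq e x y : symmetric e -> (root e x = root e y) <-> connect e x y.
Proof. by move=> es; split=> /(rootP (sym_connect_sym es)). Qed.

Section Compare.
Variables e1 e2 : rel T.
Hypotheses (e1s : symmetric e1) (e2s : symmetric e2).

Lemma leq_card_roots (A : {set T}) :
  {in A &, forall x y, connect e1 x y -> connect e2 x y} ->
  #|root e2 @: A| <= #|root e1 @: A|.
Proof.
move=> sub; apply: leq_card_imset_ker => x y Ax Ay /(connect_root_eq _ _ e1s) c.
exact/(connect_root_eq _ _ e2s)/sub.
Qed.

Lemma nclass_sub : subrel e1 (connect e2) -> nclass e2 <= nclass e1.
Proof. by move=> sub; apply: leq_card_roots => x y _ _; apply: connect_sub. Qed.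

Lemma nclass_link z1 z2 : subrel e2 (connect (link e1 z1 z2)) ->
  nclass e1 <= (nclass e2).+1.
Proof.
move=> sub.
(* [g] redirects the class of [z1] to that of [z2], so it is constant along [link e1 z1 z2], hence
   on the components of [e2]. At most the root of [z1] is missing from its values. *)
pose g x := if root e1 x == root e1 z1 then root e1 z2 else root e1 x.
apply: (@leq_trans #|root e1 z1 |: g @: [set: T]|).
  apply: subset_leq_card; apply/subsetP=> _ /imsetP[x _ ->]; rewrite !inE.
  have [//|ne] := eqVneq (root e1 x) (root e1 z1).
  by apply/imsetP; exists x; rewrite // /g (negPf ne).
rewrite cardsU1; case: (_ \notin _) => /=; rewrite ?add0n ?add1n ?ltnS.
  2: apply: leqW.
all: apply: leq_card_imset_ker => x y _ _ /(connect_root_eq _ _ e2s).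
all: move/(connect_sub sub) => /connectP[p]; elim: p x => [|z p IH] x /=; first by move=> _ ->.
all: move=> /andP[exz pz] lz; rewrite -(IH _ pz lz) {IH pz lz}.
all: case/or3P: exz => [|/andP[/eqP-> /eqP->]|/andP[/eqP-> /eqP->]]; rewrite /g ?eqxx.
all: try by case: ifP => // /eqP.
all: move=> /connect1/(connect_root_eq _ _ e1s) -> //.
Qed.

(** [root e2] maps the roots of [e1] onto those of [e2]; the roots of [x] and [y] collide, so the
    count drops. *)
Lemma nclass_lt x y : subrel e1 (connect e2) ->
  connect e2 x y -> ~~ connect e1 x y -> nclass e2 < nclass e1.
Proof.
move=> sub c2 nc1; rewrite ltn_neqAle nclass_sub // andbT.
have r2 z : root e2 (root e1 z) = root e2 z.
  apply/(connect_root_eq _ _ e2s); apply: (connect_sub sub).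
  by rewrite (sym_connect_sym e1s) connect_root.
have E : root e2 @: [set: T] = root e2 @: (root e1 @: [set: T]).
  by rewrite -imset_comp; apply: eq_imset => z /=; rewrite r2.
rewrite /nclass E; apply/imset_injP => inj.
have := inj (root e1 x) (root e1 y); rewrite !imset_f ?inE // !r2 => /(_ isT isT).
move=> /(_ ((connect_root_eq _ _ e2s).2 c2)) /(connect_root_eq _ _ e1s) c1.
by rewrite c1 in nc1.
Qed.

End Compare.

Lemma connect_isolated e x y : (forall z, e x z -> z = x) -> connect e x y -> y = x.
Proof.
move=> iso /connectP[p]; elim: p => [_ ->//|z p IH] /= /andP[/iso-> pz]; exact: IH.
Qed.

Lemma nclass_le_card e (A : {set T}) : symmetric e ->
  (forall x, exists2 y, y \in A & connect e x y) -> nclass e <= #|A|.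
Proof.
move=> es cA; apply: leq_trans (leq_imset_card (root e) A).
apply: subset_leq_card; apply/subsetP=> _ /imsetP[x _ ->].
by have [y Ay /(connect_root_eq _ _ es)->] := cA x; apply: imset_f.
Qed.

End Classes.

(** * Matchings as permutations: components, cycles and reroutings *)

Section Perms.
Variable T : finType.
Implicit Types (s t : {perm T}) (l : seq {perm T}) (x y u w : T).

(* The graph drawn by a list of permutations has two copies of [T], white and
   black; each [s] joins white [x] to black [s x].  Its components are counted
   on the white copy. *)
Definition meet l : rel T := [rel x y | has (fun s => has (fun t => s x == t y) l) l].
Definition ncomp l := nclass (meet l).

(** Relates a white vertex to the black vertices of its component. *)
Definition reach l x y := [exists z, connect (meet l) x z && has (fun s => s z == y) l].

Lemma meetP l x y :
  reflect (exists s t, [/\ s \in l, t \in l & s x = t y]) (meet l x y).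
Proof.
apply: (iffP hasP) => [[s ls /hasP[t lt /eqP st]]|[s [t [ls lt st]]]]; first by exists s, t.
by exists s => //; apply/hasP; exists t => //; apply/eqP.
Qed.

Lemma meet_sym l : symmetric (meet l).
Proof. by move=> x y; apply/meetP/meetP => -[s [t [? ? ?]]]; exists t, s. Qed.

Lemma connect_meetC l : connect_sym (meet l).
Proof. exact/sym_connect_sym/meet_sym. Qed.

Lemma eq_meet l l' : l =i l' -> meet l =2 meet l'.
Proof.
by move=> ll x y; apply/meetP/meetP => -[s [t [ls lt st]]]; exists s, t; rewrite ?ll // -?ll.
Qed.

Lemma eq_ncomp l l' : l =i l' -> ncomp l = ncomp l'.
Proof.
move=> ll; rewrite /ncomp /nclass; congr #|pred_of_set _|; apply: eq_imset.
by apply: eq_root; apply: eq_meet.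
Qed.

Lemma reach1 l s x : s \in l -> reach l x (s x).
Proof. by move=> ls; apply/existsP; exists x; rewrite connect0; apply/hasP; exists s. Qed.

Lemma reach_connect l x x' y : reach l x y -> reach l x' y -> connect (meet l) x x'.
Proof.
move=> /existsP[z /andP[xz /hasP[s ls /eqP sz]]] /existsP[z' /andP[xz' /hasP[t lt /eqP tz']]].
apply: (connect_trans xz); rewrite (same_connect_r (connect_meetC l) (y := z')); last exact: xz'.
by apply: connect1; apply/meetP; exists s, t; rewrite sz tz'.
Qed.

Lemma connect_reach l x x' y : connect (meet l) x x' -> reach l x' y -> reach l x y.
Proof.
move=> xx' /existsP[z /andP[xz sz]]; apply/existsP; exists z.
by rewrite sz andbT (connect_trans xx').
Qed.

(** Abstracts lying in a common component, for a white and a black vertex: three sides of a square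
    give the fourth. Rerouting along a pair of such a relation stays inside it. *)
Definition difunctional (R : T -> T -> Prop) :=
  forall x x' y y', R x y -> R x' y -> R x' y' -> R x y'.

Lemma reach_difunctional l : difunctional (reach l).
Proof. by move=> x x' y y' xy x'y x'y'; apply: connect_reach x'y'; apply: reach_connect x'y. Qed.

Lemma meet_sub l l' : (forall s x, s \in l -> reach l' x (s x)) ->
  subrel (meet l) (connect (meet l')).
Proof.
move=> ll' x y /meetP[s [t [ls lt st]]].
by apply: (reach_connect (ll' s x ls)); rewrite st ll'.
Qed.

(** Every edge of [l] becomes an edge of [l'] once its white end is moved within a component of
    [link (meet l') u v], so [l] connects no more than [l'] with [u] and [v] joined. *)
Lemma ncomp_link l l' u v :
  (forall r x, r \in l -> exists r' x', [/\ r' \in l',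
     connect (link (meet l') u v) x x' & r x = r' x']) ->
  ncomp l' <= (ncomp l).+1.
Proof.
move=> H; apply: (@nclass_link _ _ _ (@meet_sym _) (@meet_sym _) u v).
have lC : connect_sym (link (meet l') u v).
  by apply: sym_connect_sym; apply: link_sym; apply: meet_sym.
move=> x y /meetP[r [r' [lr lr' rr']]].
have [q [x' [lq xx' rq]]] := H r x lr; have [q' [y' [lq' yy' rq']]] := H r' y lr'.
apply: (connect_trans xx'); rewrite lC; apply: (connect_trans yy'); rewrite lC.
apply: connect1; apply/orP; left.
by apply/meetP; exists q, q'; rewrite -rq -rq'.
Qed.

Lemma connect_tperm (e : rel T) u v x : symmetric e -> connect e u v ->
  connect e x (tperm u v x).
Proof.
by move=> es uv; case: tpermP => [->|->|]; rewrite ?connect0 // (sym_connect_sym es).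
Qed.

Lemma connect_link (e : rel T) u v : connect (link e u v) u v.
Proof. by apply: connect1; rewrite /link /= !eqxx orbT. Qed.

Lemma ncomp_tperm s l u v : ncomp (tperm u v * s :: l) <= (ncomp (s :: l)).+1.
Proof.
apply: (@ncomp_link _ _ u v) => r x.
rewrite inE => /orP[/eqP->|lr]; last by exists r, x; rewrite inE lr orbT connect0.
exists (tperm u v * s), (tperm u v x); rewrite inE eqxx permM tpermK; split=> //.
by apply: connect_tperm; [apply: link_sym; apply: meet_sym | apply: connect_link].
Qed.

Lemma ncomp_le_card l : ncomp l <= #|T|.
Proof. by rewrite -cardsT; apply: leq_imset_card. Qed.

(** The cycles of [s * t^-1] are the alternating cycles of the union of two matchings; a fixed point
    is a pair of parallel edges. *)
Definition cyc s t := #|porbits (s * t^-1)|.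

Lemma cycC s t : cyc s t = cyc t s.
Proof. by rewrite /cyc -porbitsV invMg invgK. Qed.

Lemma cycss s : cyc s s = #|T|.
Proof.
rewrite /cyc mulgV /porbits card_imset ?cardT // => x y /eqP; rewrite eq_porbit_mem.
by move=> /porbitP[i ->]; rewrite expg1n perm1.
Qed.

Lemma cyc_tperm s t x y : cyc s t <= (cyc (tperm x y * s) t).+1.
Proof.
have := porbits_mul_tperm (tperm x y * s * t^-1) x y.
rewrite /= !mulgA tperm2 mul1g -/(cyc s t) -/(cyc (tperm x y * s) t) => E.
by move: E; case: (_ \notin _); case: (x != y) => /=; lia.
Qed.

(* [ctr s u w] reroutes the edges of [s] so that white [u] is joined to black [w]. *)
Definition ctr s u w : {perm T} := tperm u (s^-1 w) * s.

Lemma ctrE s u w x : ctr s u w x = if x == u then w else if s x == w then s u else s x.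
Proof.
rewrite permM; case: (eqVneq x u) => [->|nxu]; first by rewrite tpermL permKV.
case: (eqVneq (s x) w) => [<-|nsx]; first by rewrite permK tpermR.
by rewrite tpermD // ?[u == _]eq_sym // -(inj_eq (@perm_inj _ s)) permKV eq_sym.
Qed.

Lemma ctr_u s u w : ctr s u w u = w.
Proof. by rewrite ctrE eqxx. Qed.

Lemma ctr_id s u w : s u = w -> ctr s u w = s.
Proof. by move=> <-; rewrite /ctr permK tperm1 mul1g. Qed.

(** White [u] and black [w] lie on a common alternating cycle of [s] and [t]; the cycle of [w] is
    located through its white neighbor [s^-1 w]. *)
Definition same s t u w := u \in porbit (s * t^-1) (s^-1 w).

Lemma same_l s t u w : s u = w -> same s t u w.
Proof. by move=> <-; rewrite /same permK porbit_id. Qed.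

Lemma same_r s t u w : t u = w -> same s t u w.
Proof.
move=> <-; rewrite /same; have := mem_porbit (s * t^-1) 1 (s^-1 (t u)).
by rewrite expg1 permM permKV permK.
Qed.

(** Rerouting multiplies by the transposition of [u] and [s^-1 w]: it splits their cycle if they
    share one, merges two cycles otherwise, and does nothing if [s u = w]. *)
Lemma cyc_ctr s t u w :
  cyc (ctr s u w) t + (~~ same s t u w).*2 = cyc s t + (s u != w).
Proof.
have := porbits_mul_tperm (s * t^-1) u (s^-1 w); rewrite /= mulgA.
by rewrite -(inj_eq (@perm_inj _ s) u) permKV.
Qed.

Lemma cyc_ctr_adj s t u w : t u = w -> cyc (ctr s u w) t = cyc s t + (s u != w).
Proof. by move=> tu; rewrite -cyc_ctr same_r // addn0. Qed.

Lemma cyc_ctr_le s t u w : cyc (ctr s u w) t <= cyc s t + (s u != w).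
Proof. by rewrite -cyc_ctr leq_addr. Qed.

Lemma cyc_ctr2 s t u w : cyc (ctr s u w) (ctr t u w) + (~~ same s t u w).*2
  = cyc s t + (s u != w) + (t u != w).
Proof.
rewrite -cyc_ctr cycC cyc_ctr_adj ?ctr_u // [cyc t _]cycC; lia.
Qed.

Lemma ncomp_ctr s l u w : ncomp (ctr s u w :: l) <= ncomp (s :: l) + (s u != w).
Proof.
have [/ctr_id->|_] := eqVneq (s u) w; first by rewrite addn0.
by rewrite addn1 ncomp_tperm.
Qed.

Lemma ctr_difunctional (R : T -> T -> Prop) s u w : difunctional R ->
  (forall x, R x (s x)) -> R u w -> forall x, R x (ctr s u w x).
Proof.
move=> dR sR uw x; rewrite ctrE; case: eqP => [->//|_]; case: eqP => [sx|//].
by apply: dR uw (sR u); rewrite -sx.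
Qed.

(* Contracting at every pair [(u, th u)] with [u \in D] leaves, outside [D], the
   first-return matching of [s]. *)
Lemma ctr_on (D : {set T}) (th s : {perm T}) : exists s' n,
  [/\ {in D, s' =1 th},
      forall g : {perm T}, {in D, g =1 th} -> cyc g s' = cyc g s + n,
      forall l, ncomp (s' :: l) <= ncomp (s :: l) + n
    & forall R : T -> T -> Prop, difunctional R -> (forall x, R x (s x)) ->
      (forall x, x \in D -> R x (th x)) -> forall x, R x (s' x)].
Proof.
have [m] := ubnP #|D|; elim: m D => // m IH D.
case: (set_0Vmem D) => [-> _|[u Du]].
  exists s, 0; split=> [x|g _|l|R _ sR _ //]; rewrite ?inE ?addn0 //.
rewrite (cardsD1 u) Du => /IH[s0 [n [s0E s0c s0l s0R]]].
(* [n] counts the reroutings that change the permutation; each adds one cycle against any [g] that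
   agrees with [th] on [D]. *)
exists (ctr s0 u (th u)), (n + (s0 u != th u)); split.
- move=> x Dx; rewrite ctrE; case: eqVneq => [->//|nxu].
  by rewrite s0E ?inE ?nxu // (inj_eq perm_inj) (negPf nxu).
- move=> g gE; rewrite cycC cyc_ctr_adj ?gE // cycC s0c ?addnA // => x.
  by rewrite !inE => /andP[_ /gE].
- by move=> l; rewrite addnA (leq_trans (ncomp_ctr _ _ _ _)) // leq_add2r.
- move=> R dR sR tR; apply: ctr_difunctional (tR u Du) => //; apply: s0R => // x.
  by rewrite !inE => /andP[_ /tR].
Qed.

End Perms.

(** * Planar families of three permutations *)

Lemma third (a b : 'I_3) : a != b ->
  exists2 c, a != c /\ b != c & forall e, e \in [:: a; b; c].
Proof.
move=> nab; have /card_gt0P[c] : 0 < #|~: [set a; b]|.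
  by have := cardsC [set a; b]; rewrite cards2 nab card_ord; lia.
rewrite !inE negb_or => /andP[nca ncb]; exists c; first by rewrite ![_ == c]eq_sym.
move=> e; have /subset_leqif_card[_] := subsetT [set a; b; c].
rewrite cardsT card_ord setUC cardsU1 cards2 nab !inE negb_or nca ncb /= eqxx => /esym.
by move=> /subsetP/(_ e (in_setT _)); rewrite !inE => /or3P[->|->|->]; rewrite ?orbT.
Qed.

Lemma sum3 (F : 'I_3 -> nat) (a b c : 'I_3) : a != b -> a != c -> b != c ->
  \sum_(e < 3) F e = F a + F b + F c.
Proof.
move=> ab ac bc; have [d [ad bd] abd] := third ab.
have cd : c = d by have := abd c; rewrite !inE (eq_sym c a) (eq_sym c b) (negPf ac) (negPf bc) => /eqP.
rewrite (bigD1 a) //= (bigD1 b) 1?eq_sym //= (bigD1 c) /=; last by rewrite eq_sym ac eq_sym bc.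
rewrite big_pred0 ?addn0 ?addnA // => e.
by have := abd e; rewrite cd !inE => /or3P[/eqP->|/eqP->|/eqP->]; rewrite eqxx ?andbF.
Qed.

Lemma ordS3 (x y z : 'I_3) : x != y -> x != z -> y != z ->
  [/\ ordS x = y, ordS y = z & ordS z = x] \/
  [/\ ordS x = z, ordS z = y & ordS y = x].
Proof.
case: x y z => [[|[|[|]]] //= ?] [[|[|[|]]] //= ?] [[|[|[|]]] //= ?] n1 n2 n3.
all: first [by move: n1 n2 n3 | by left; split; apply/eqP | by right; split; apply/eqP].
Qed.

Section Families.
Variable T : finType.
Implicit Types (f g : 'I_3 -> {perm T}) (a b c : 'I_3) (u w x y : T).

Definition fam f := [seq f c | c <- enum 'I_3].

Lemma famP f s : reflect (exists c, s = f c) (s \in fam f).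
Proof.
by apply: (iffP mapP) => [[c _ ->]|[c ->]]; exists c => //; rewrite mem_enum.
Qed.

Lemma mem_fam f c : f c \in fam f.
Proof. by apply/famP; exists c. Qed.

Lemma fam3 f a b c : (forall e, e \in [:: a; b; c]) -> fam f =i [:: f a; f b; f c].
Proof.
move=> abc s; apply/famP/idP => [[e ->]|].
  by have := abc e; rewrite !inE => /or3P[/eqP->|/eqP->|/eqP->]; rewrite eqxx ?orbT.
by rewrite !inE => /or3P[/eqP->|/eqP->|/eqP->]; eexists.
Qed.

Definition score f g := \sum_(c < 3) cyc (f c) (g c).
Definition score1 f s := \sum_(c < 3) cyc (f c) s.
Definition faces f := \sum_(c < 3) cyc (f c) (f (ordS c)).
(** Euler's formula: with [#|T|] white and [#|T|] black vertices, three edges per white vertex and K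
    components, genus 0 means [#|T|] + 2K faces. *)
Definition planar_fam f := #|T| + (ncomp (fam f)).*2 <= faces f.
Definition ctrf f u w c := ctr (f c) u w.

Lemma faces3 f a b c : a != b -> a != c -> b != c ->
  faces f = cyc (f a) (f b) + cyc (f a) (f c) + cyc (f b) (f c).
Proof.
move=> ab ac bc; rewrite /faces (sum3 _ ab ac bc).
have [[-> -> ->]|[-> -> ->]] := ordS3 ab ac bc.
  rewrite [cyc (f c) (f a)]cycC; lia.
rewrite [cyc (f b) (f a)]cycC [cyc (f c) (f b)]cycC; lia.
Qed.

(* If [u] and [w] lie on different faces of colors [s], [t], then rerouting
   both colors merges these faces, so it separates nothing but [u] and [w]. *)
Lemma connect_merged_face s t u w l : ctr s u w \in l -> ctr t u w \in l ->
  ~~ same s t u w -> connect (meet l) (s^-1 w) (t^-1 w).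
Proof.
move=> ls lt ns; set v := s^-1 w; set v' := t^-1 w.
have su : s u != w by apply: contra ns => /eqP; apply: same_l.
have tu : t u != w by apply: contra ns => /eqP; apply: same_r.
have vu : v != u by rewrite -(inj_eq (@perm_inj _ s)) permKV eq_sym.
have v'u : v' != u by rewrite -(inj_eq (@perm_inj _ t)) permKV eq_sym.
have sv : ctr s u w v = s u by rewrite ctrE (negPf vu) permKV eqxx.
have tv' : ctr t u w v' = t u by rewrite ctrE (negPf v'u) permKV eqxx.
pose p := s * t^-1.
have pv : p v = v' by rewrite permM permKV.
have mt x y : ctr s u w x = ctr t u w y -> connect (meet l) x y.
  by move=> E; apply: connect1; apply/meetP; exists (ctr s u w), (ctr t u w).
have nO x : x \in porbit p u -> x != v /\ x != v'.
  rewrite porbit_sym => xu; split; apply: contraNneq ns => E; rewrite /same -/p -/v -?E //.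
  by have := porbit_perm p 1 v; rewrite expg1 pv -E => <-.
(* Follow the orbit of [u] under [p]: its vertices other than [u] are still joined to [v], and the
   last one before the return to [u] is joined to [v']. *)
suff P i : let x := (p ^+ i) u in x = u \/ connect (meet l) v x.
  have [i /(congr1 p) pi] : exists i, p^-1 u = (p ^+ i) u.
    by apply/porbitP; rewrite -porbitV; have := mem_porbit p^-1 1 u; rewrite expg1.
  rewrite permKV in pi.
  have tux : t u = s ((p ^+ i) u) by rewrite {1}pi permM permKV.
  have [xu|cx] := P i.
    by apply: mt; rewrite sv tv' tux xu.
  have [xu|nxu] := eqVneq ((p ^+ i) u) u; first by apply: mt; rewrite sv tv' tux xu.
  apply: connect_trans cx _; apply: mt; rewrite tv' tux ctrE (negPf nxu).
  by rewrite -tux (negPf tu).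
elim: i => [|i /= IH]; first by left; rewrite expg0 perm1.
set x := (p ^+ i) u in IH *; rewrite expgSr permM -/x.
have [->|npu] := eqVneq (p x) u; first by left.
have Opx : p x \in porbit p u.
  by have := mem_porbit p i.+1 u; rewrite expgSr permM.
right; have [nv nv'] := nO _ Opx.
have tpx : ctr t u w (p x) = s x.
  rewrite ctrE (negPf npu) permM permKV; case: eqP => // sx.
  have Ox : x \in porbit p u by apply: mem_porbit.
  by have [] := nO _ Ox; rewrite /v -sx permK eqxx.
case: IH => [xu|cx]; first by apply: mt; rewrite sv tpx xu.
have [xu|nxu] := eqVneq x u; first by apply: mt; rewrite sv tpx xu.
apply: connect_trans cx _; apply: mt; rewrite tpx ctrE (negPf nxu); case: eqP => // sx.
have Ox : x \in porbit p u by apply: mem_porbit.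
by have [] := nO _ Ox; rewrite /v -sx permK eqxx.
Qed.

(** Let b and c be the colors other than [a]. Each of them that is really rerouted adds one face
    with color [a]. If [u] and [w] share a face of colors b and c, those faces grow equally, which
    covers twice the new components. Otherwise their number is unchanged, but only one component can
    split off. *)
Lemma planar_ctr f u a : planar_fam f -> planar_fam (ctrf f u (f a u)).
Proof.
rewrite /planar_fam; set w := f a u => pf.
have [b nab] : exists b : 'I_3, a != b.
  by exists (ordS a); case: (a) => [[|[|[|]]] //= ?].
have [c [nac nbc] abc] := third nab.
rewrite (eq_ncomp (fam3 _ abc)) (faces3 _ nab nac nbc) /ctrf.
move: pf; rewrite (eq_ncomp (fam3 _ abc)) (faces3 _ nab nac nbc).
rewrite [ctr (f a) u w]ctr_id //.
rewrite [cyc (f a) (ctr _ _ _)]cycC cyc_ctr_adj // [cyc (f b) (f a)]cycC.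
rewrite [cyc (f a) (ctr (f c) _ _)]cycC cyc_ctr_adj // [cyc (f c) (f a)]cycC.
have := cyc_ctr2 (f b) (f c) u w.
set l := [:: f a; ctr (f b) u w; ctr (f c) u w].
have B : ncomp l <= ncomp [:: f a; f b; f c] + (f b u != w) + (f c u != w).
  rewrite (@eq_ncomp _ l [:: ctr (f c) u w; f a; ctr (f b) u w]).
    apply: leq_trans (ncomp_ctr _ _ _ _) _; rewrite leq_add2r.
    rewrite (@eq_ncomp _ _ [:: ctr (f b) u w; f a; f c]).
      apply: leq_trans (ncomp_ctr _ _ _ _) _; rewrite leq_add2r.
      by rewrite (@eq_ncomp _ _ [:: f a; f b; f c]) // => s; rewrite !inE; do !case: eqP.
    by move=> s; rewrite !inE; do !case: eqP.
  by move=> s; rewrite !inE; do !case: eqP.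
have [sm|ns] := boolP (same (f b) (f c) u w) => /=; first by move: B; lia.
have -> : (f b u != w) by apply: contra ns => /eqP; apply: same_l.
have -> : (f c u != w) by apply: contra ns => /eqP; apply: same_r.
(* The single link of [u] and [vb] undoes both reroutings, since [vb] and [vc] stay connected in
   [l]. *)
have : ncomp l <= (ncomp [:: f a; f b; f c]).+1; last by lia.
set vb := (f b)^-1 w; set vc := (f c)^-1 w.
have lks : symmetric (link (meet l) u vb) by apply: link_sym; apply: meet_sym.
apply: (@ncomp_link _ _ _ u vb) => r x; rewrite !inE => /or3P[] /eqP->.
- by exists (f a), x; rewrite connect0 inE eqxx.
- exists (ctr (f b) u w), (tperm u vb x); rewrite !inE eqxx orbT permM tpermK; split=> //.
  by apply: connect_tperm => //; apply: connect_link.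
- exists (ctr (f c) u w), (tperm u vc x); rewrite !inE eqxx !orbT permM tpermK; split=> //.
  apply: connect_tperm => //; apply: connect_trans (connect_link _ _ _) _.
  apply: (@connect_sub _ (meet l)) => [y z myz|].
    by apply: connect1; rewrite /link /= myz.
  by apply: connect_merged_face ns; rewrite !inE eqxx ?orbT.
Qed.

(** The vertices left out have three parallel edges, and each is a component of its own. Contraction
    shrinks this set, which drives the induction of [planar_gap]. *)
Definition nondip f := [set u | [exists c, f c u != f ord0 u]].

Lemma nondipPn f u : u \notin nondip f -> forall c d, f c u = f d u.
Proof.
by rewrite inE negb_exists => /forallP H c d; rewrite (eqP (negbNE (H c))) (eqP (negbNE (H d))).
Qed.

Lemma nondipI f u c d : f c u != f d u -> u \in nondip f.
Proof. by apply: contraNT => /nondipPn/(_ c d)/eqP. Qed.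

Lemma nondip_ctr f u a : nondip (ctrf f u (f a u)) \subset nondip f :\ u.
Proof.
apply/subsetP=> x; apply: contraLR; rewrite in_setD1 negb_and negbK => /orP[/eqP->|nx].
  by rewrite inE negb_exists; apply/forallP=> c; rewrite /ctrf !ctr_u eqxx.
rewrite inE negb_exists; apply/forallP=> c; rewrite /ctrf !ctrE.
have [_|nxu] := eqVneq x u; first by rewrite eqxx.
by rewrite !(nondipPn nx _ a) (inj_eq perm_inj) (negPf nxu) eqxx.
Qed.


(** With weight 3 on [D] and weight 1 elsewhere, every orbit weighs at least 3. *)
Lemma porbits_short (p : {perm T}) (D : {set T}) :
  {in ~: D, forall x, p x != x /\ p (p x) != x} ->
  3 * #|porbits p| <= #|T| + #|D|.*2.
Proof.
move=> H; pose F x := (1 + (x \in D).*2)%N.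
have -> : (#|T| + #|D|.*2)%N = \sum_(x : T) F x.
  rewrite big_split /= sum1_card -(@big_morph _ _ double 0 addn 0 addn doubleD) //.
  by congr (_ + _.*2)%N; rewrite -sum1_card [RHS]big_mkcond [LHS]big_mkcond /=; apply: eq_bigr => x _; case: (x \in D).
rewrite (partition_big (porbit p) (mem (porbits p))) => [|x _] /=; last exact: imset_f.
rewrite mulnC -sum_nat_const; apply: leq_sum => _ /imsetP[x _ ->].
have [Dx|nDx] := boolP (x \in D).
  by rewrite (bigD1 x) //= /F Dx leq_addr.
have [|n1 n2] := H x; first by rewrite inE.
have [e1 e2] : porbit p (p x) = porbit p x /\ porbit p (p (p x)) = porbit p x.
  by have := porbit_perm p 1 x; have := porbit_perm p 2 x; rewrite expg1 expgS expg1 permM => -> ->.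
rewrite (bigD1 x) //= (bigD1 (p x)) ?e1 ?eqxx //= (bigD1 (p (p x))) /=.
  by rewrite /F; lia.
by rewrite e2 n2 eqxx /= inj_eq //; apply: perm_inj.
Qed.

(* Euler's relation: a planar map of degree 3 whose faces have even length has
   a face of length 2 or 4. *)
Lemma short_face f : planar_fam f -> nondip f != set0 ->
  exists a b u1 u2, [/\ a != b, u1 \in nondip f, f a u1 = f b u2 & f a u2 = f b u1].
Proof.
move=> pf /set0Pn[u0 nu0]; set D := ~: nondip f.
have [/existsP[a /existsP[b /existsP[u1 /existsP[u2 /and4P[ab nu /eqP e1 /eqP e2]]]]]|no] :=
  boolP [exists a, exists b, exists u1, exists u2,
    [&& a != b, u1 \in nondip f, f a u1 == f b u2 & f a u2 == f b u1]].
  by exists a, b, u1, u2.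
have ns a b : a != b -> 3 * cyc (f a) (f b) <= #|T| + #|D|.*2.
  move=> ab; apply: porbits_short => x; rewrite !in_setC negbK => nx; split.
    apply: contra no => /eqP px.
    apply/existsP; exists a; apply/existsP; exists b; apply/existsP; exists x; apply/existsP; exists x.
    have E : f a x = f b x by rewrite -{2}px permM permKV.
    by apply/and4P; split=> //; apply/eqP.
  apply: contra no => /eqP px; set y := (f a * (f b)^-1) x in px.
  apply/existsP; exists a; apply/existsP; exists b; apply/existsP; exists x; apply/existsP; exists y.
  by apply/and4P; split=> //; apply/eqP; [rewrite /y permM permKV | rewrite -px permM permKV].
(* Each vertex of [D] is a component by itself, and [u0] lies in a further one. By [ns] there are at
   most [#|T|] + 2[#|D|] faces, which contradicts planarity. *)
have K : #|D| < ncomp (fam f).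
  have -> : #|D|.+1 = #|u0 |: D| by rewrite cardsU1 in_setC negbK nu0.
  rewrite /ncomp /nclass -(card_in_imset (f := root (meet (fam f))) (D := u0 |: D)).
    by apply: subset_leq_card; apply: imsetS; apply: subsetT.
  have iso x y : x \in D -> connect (meet (fam f)) x y -> y = x.
    rewrite in_setC => nx; apply: connect_isolated => z /meetP[s [t [/famP[c ->] /famP[d ->]]]].
    by rewrite (nondipPn nx c d) => /perm_inj.
  move=> x y; rewrite !in_setU1 => Dx Dy /(connect_root_eq _ _ (@meet_sym _ _)) c.
  case/orP: Dx => [/eqP Ex|/iso/(_ c)//]; case/orP: Dy => [/eqP Ey|Dy]; first by rewrite Ex Ey.
  by apply: (iso y x Dy); rewrite connect_meetC.
move: pf; rewrite /planar_fam (@faces3 f ord0 (lift ord0 ord0) ord_max) //.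
have := ns ord0 (lift ord0 ord0) isT; have := ns ord0 ord_max isT.
have := ns (lift ord0 ord0) ord_max isT; have := cardsC D; lia.
Qed.

(** The key inequality with slack [n]; [s] and [t] are closings of [f] and of [g]. *)
Definition gap f g n := exists s t : {perm T},
  (score f g + 3 * ncomp (t :: fam g) + n <= score1 f s + score1 g t)%N.

Lemma score1_ctr f s u w :
  score1 (ctrf f u w) s <= score1 f s + \sum_(c < 3) (f c u != w).
Proof. by rewrite /score1 -big_split; apply: leq_sum => c _; apply: cyc_ctr_le. Qed.

(** As [g] joins [u] to [w] in every color, rerouting [f] raises the score by the full amount that
    bounds the growth of [score1 f s]. *)
Lemma gap_ctr_dip f g u w n : (forall c, g c u = w) ->
  gap (ctrf f u w) g n -> gap f g n.
Proof.
move=> gu [s [t H]]; exists s, t; have := score1_ctr f s u w.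
suff : score (ctrf f u w) g = (score f g + \sum_(c < 3) (f c u != w))%N by move: H; lia.
by rewrite /score -big_split; apply: eq_bigr => c _; apply: cyc_ctr_adj.
Qed.

Definition nsame f g u w := \sum_(c < 3) same (f c) (g c) u w.

(** After the contraction [u] and [w] form an isolated component, as [t] joins them too; undoing it
    attaches them to another one. *)
Lemma fam_ctr_lt g (t : {perm T}) u w : t u = w -> [exists c, g c u != w] ->
  ncomp (t :: fam g) < ncomp (t :: fam (ctrf g u w)).
Proof.
move=> tu /existsP[c gc]; set l := t :: fam g; set l' := t :: _.
have uv d : connect (meet l) u ((g d)^-1 w).
  apply: connect1; apply/meetP; exists t, (g d); rewrite permKV.
  by rewrite !inE eqxx mem_fam orbT.
apply: (nclass_lt (@meet_sym _ _) (@meet_sym _ _) _ (uv c)).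
  apply: meet_sub => s x; rewrite inE => /orP[/eqP->|/famP[d ->]].
    by apply: reach1; rewrite inE eqxx.
  rewrite permM; apply: (@connect_reach _ _ _ (tperm u ((g d)^-1 w) x)).
    by apply: connect_tperm => //; apply: meet_sym.
  by apply: reach1; rewrite inE mem_fam orbT.
apply: contra gc => cuv; apply/eqP; suff -> : u = (g c)^-1 w by rewrite permKV.
apply/esym; apply: connect_isolated cuv => z /meetP[s [r [ls lr sr]]].
have W q : q \in l' -> q u = w.
  by rewrite inE => /orP[/eqP->//|/famP[d ->]]; rewrite /ctrf ctr_u.
by apply: (@perm_inj _ r); rewrite -sr !W.
Qed.

(** Beyond the growth that the closings can match, the score changes by 2[nsame] - 6, and undoing
    the contraction removes a component, worth 3. The slack changes by 2[nsame] - 3: two colors with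
    [same] gain 1, a single one loses 1. *)
Lemma gap_ctr f g u w n n' : [exists c, g c u != w] ->
  (n' + 3 <= n + (nsame f g u w).*2)%N ->
  gap (ctrf f u w) (ctrf g u w) n -> gap f g n'.
Proof.
(* If [t'] does not join [u] to [w], rerouting it gains one cycle in each of three colors and
   creates at most one component, worth 3. *)
move=> ng nn [s [t' H]]; pose t := ctr t' u w; exists s, t.
have I1 : (score (ctrf f u w) (ctrf g u w) + 6 = score f g
    + \sum_(c < 3) (f c u != w) + \sum_(c < 3) (g c u != w) + (nsame f g u w).*2)%N.
  have -> : 6%N = (\sum_(c < 3) 2)%N by rewrite sum_nat_const card_ord.
  rewrite /nsame (@big_morph _ _ double 0 addn 0 addn doubleD) // /score -!big_split /=.
  apply: eq_bigr => c _; have := cyc_ctr2 (f c) (g c) u w; rewrite /ctrf.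
  by case: (same _ _ _ _) => /=; lia.
have I2 := score1_ctr f s u w.
have I3 := score1_ctr g t u w.
have I4 : score1 (ctrf g u w) t = (score1 (ctrf g u w) t' + 3 * (t' u != w))%N.
  have -> : (3 * (t' u != w) = \sum_(c < 3) (t' u != w))%N by rewrite sum_nat_const card_ord.
  rewrite /score1 -big_split; apply: eq_bigr => c _ /=.
  by rewrite cycC cyc_ctr_adj ?ctr_u // cycC.
have I5 := ncomp_ctr t' (fam (ctrf g u w)) u w.
have I6 := fam_ctr_lt (ctr_u t' u w) ng.
move: I3 I4 I5 I6; rewrite -/t; move: H nn I1 I2; lia.
Qed.

Lemma nsame_gt0 f g u w c : same (f c) (g c) u w -> 0 < nsame f g u w.
Proof. by move=> sc; rewrite /nsame (bigD1 c) //= sc. Qed.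

Lemma nsame_gt1 f g u w c d : c != d ->
  same (f c) (g c) u w -> same (f d) (g d) u w -> 1 < nsame f g u w.
Proof.
by move=> cd sc sd; rewrite /nsame (bigD1 c) //= (bigD1 d) 1?eq_sym //= sc sd.
Qed.


Definition const_fam g := [forall c, g c == g ord0].

Lemma const_famP g : reflect (forall c d, g c = g d) (const_fam g).
Proof.
apply: (iffP forallP) => [H c d|H c]; last by apply/eqP.
by rewrite (eqP (H c)) (eqP (H d)).
Qed.

Lemma gap_const f g : const_fam g -> gap f g 0.
Proof.
move=> /const_famP cg; exists (g ord0), (g ord0); rewrite addn0.
have -> : score1 f (g ord0) = score f g.
  by apply: eq_bigr => c _; rewrite (cg c ord0).
have -> : score1 g (g ord0) = (3 * #|T|)%N.
  rewrite /score1 (eq_bigr (fun=> #|T|)) ?sum_nat_const ?card_ord // => c _.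
  by rewrite (cg c ord0) cycss.
by rewrite leq_add2l leq_mul2l ncomp_le_card.
Qed.

(** Here [f] consists of triples of parallel edges, and closing both sides along them loses nothing.
    An edge of [g] off this matching merges two components, whence strictness. *)
Lemma gap_base f g : nondip f = set0 -> ~~ const_fam g -> gap f g 1.
Proof.
move=> df ng; have cf c d : f c = f d.
  by apply/permP=> x; apply: nondipPn; rewrite df inE.
exists (f ord0), (f ord0).
have -> : score1 f (f ord0) = (3 * #|T|)%N.
  rewrite /score1 (eq_bigr (fun=> #|T|)) ?sum_nat_const ?card_ord // => c _.
  by rewrite (cf c ord0) cycss.
have -> : score1 g (f ord0) = score f g.
  by apply: eq_bigr => c _; rewrite cycC (cf c ord0).
suff : ncomp (f ord0 :: fam g) < #|T| by lia.
have [c gc] : exists c, g c != f ord0.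
  apply/existsP; apply: contraNT ng; rewrite negb_exists => /forallP H.
  by apply/const_famP=> c d; rewrite (eqP (negbNE (H c))) (eqP (negbNE (H d))).
have [x gx] : exists x, g c x != f ord0 x.
  apply/existsP; apply: contraNT gc; rewrite negb_exists => /forallP H.
  by apply/eqP/permP=> x; apply/eqP/negbNE.
pose y := (f ord0)^-1 (g c x).
have nxy : x != y by rewrite -(inj_eq (@perm_inj _ (f ord0))) permKV eq_sym.
have T0 : 0 < #|T| by apply/card_gt0P; exists x.
rewrite -(ltn_predK T0) ltnS -(cardsC1 x).
apply: nclass_le_card (@meet_sym _ _) _ => z.
have [->|nz] := eqVneq z x; last by exists z; rewrite ?inE ?connect0.
exists y; first by rewrite !inE eq_sym.
apply: connect1; apply/meetP; exists (g c), (f ord0); rewrite permKV.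
by rewrite !inE eqxx mem_fam orbT.
Qed.

(** Both closings are [t]. Each swap costs at most one cycle on either side, but removes a
    component, worth 3. *)
Lemma gap_two_swaps f g (t : {perm T}) e0 e1 e2 p q p' q' :
  e0 != e1 -> e0 != e2 -> e1 != e2 -> g e1 = t -> g e2 = t ->
  g e0 = tperm p q * tperm p' q' * t ->
  uniq [:: p; q; p'; q'] -> gap f g 1.
Proof.
move=> e01 e02 e12 g1 g2 g0; rewrite /= !inE !negb_or.
move=> /and4P[/and3P[pq pp' pq'] /andP[qp' qq'] p'q' _]; exists t, t.
have [t1 t1E] : {t1 | t1 = tperm p' q' * t} by exists (tperm p' q' * t).
have [t0 t0E] : {t0 | t0 = tperm p q * t1} by exists (tperm p q * t1).
have {}g0 : g e0 = t0 by rewrite g0 t0E t1E mulgA.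
rewrite /score /score1 !(sum3 _ e01 e02 e12) g1 g2 g0 !cycss.
have step r (x y : T) (k : {perm T}) : cyc r (tperm x y * k) <= (cyc r k).+1.
  by rewrite ![cyc r _]cycC -{2}(mul1g k) -(tperm2 x y) -mulgA cyc_tperm.
have := step (f e0) p q t1; have := step (f e0) p' q' t.
have := cyc_tperm t1 t p q; have := cyc_tperm t t p' q'.
rewrite -t1E -t0E cycss.
suff : (ncomp (t :: fam g) + 2 <= #|T|)%N by lia.
have := cardsC [set q; q']; rewrite cards2 qq' addnC => <-; rewrite leq_add2r.
apply: nclass_le_card (@meet_sym _ _) _ => z.
have mm x y : g e0 x = t y -> connect (meet (t :: fam g)) y x.
  move=> E; rewrite connect_meetC; apply: connect1; apply/meetP; exists (g e0), t.
  by rewrite !inE eqxx mem_fam orbT.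
have [->|nq] := eqVneq z q.
  exists p; first by rewrite !inE negb_or pq pq'.
  by apply: mm; rewrite g0 t0E t1E !permM tpermL tpermD // eq_sym.
have [->|nq'] := eqVneq z q'.
  exists p'; first by rewrite !inE negb_or eq_sym qp' p'q'.
  by apply: mm; rewrite g0 t0E t1E !permM (tpermD pp' qp') tpermL.
by exists z; rewrite ?inE ?negb_or ?nq ?nq' ?connect0.
Qed.

(** * The exceptional case of a face of length 4 *)

Section DoubleContraction.
Variables (g : 'I_3 -> {perm T}) (c : 'I_3) (u1 u2 w1 w2 : T).
Hypotheses (nu : u1 != u2) (nw : w1 != w2).
Hypotheses (n11 : g c u1 != w1) (n12 : g c u1 != w2).
Hypotheses (n21 : g c u2 != w1) (n22 : g c u2 != w2).
Hypothesis (cP : const_fam (ctrf (ctrf g u1 w1) u2 w2)).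
Hypothesis (cQ : const_fam (ctrf (ctrf g u1 w2) u2 w1)).

Let h := g c.
Let s := h^-1 w1.
Let t := h^-1 w2.

(** The equations at [s] and [t] force [g e] to map this pair onto [w1], [w2], in one order or the
    other. Either order determines [g e] at [u1] and [u2]; at the remaining points the contractions
    leave it unchanged. *)
Lemma double_contraction e :
  g e = h \/ g e = tperm u1 u2 * tperm s t * h.
Proof.
set k := g e.
have hs : h s = w1 by rewrite permKV.
have ht : h t = w2 by rewrite permKV.
have ne z z' : h z != h z' -> z != z' by apply: contra => /eqP->.
have su1 : s != u1 by apply: ne; rewrite hs eq_sym.
have su2 : s != u2 by apply: ne; rewrite hs eq_sym.
have tu1 : t != u1 by apply: ne; rewrite ht eq_sym.
have tu2 : t != u2 by apply: ne; rewrite ht eq_sym.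
have st : s != t by apply: ne; rewrite hs ht.
have nw' : w2 != w1 by rewrite eq_sym.
have nu' : u2 != u1 by rewrite eq_sym.
have PE z : ctr (ctr k u1 w1) u2 w2 z = ctr (ctr h u1 w1) u2 w2 z.
  by have /const_famP/(_ e c)/(congr1 (fun q : {perm T} => q z)) := cP.
have QE z : ctr (ctr k u1 w2) u2 w1 z = ctr (ctr h u1 w2) u2 w1 z.
  by have /const_famP/(_ e c)/(congr1 (fun q : {perm T} => q z)) := cQ.
have hxy : h u1 != h u2 by rewrite (inj_eq perm_inj).
have Ps := PE s; have Qs := QE s; have Pt := PE t; have Qt := QE t.
rewrite !ctrE (negPf su1) (negPf su2) hs ?eqxx (negPf n12) in Ps.
rewrite !ctrE (negPf su1) (negPf su2) (negPf nu') hs (negPf nw) (negPf n22) ?eqxx in Qs.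
rewrite !ctrE (negPf tu1) (negPf tu2) (negPf nu') ht (negPf nw') (negPf n21) ?eqxx in Pt.
rewrite !ctrE (negPf tu1) (negPf tu2) ht ?eqxx (negPf n11) in Qt.
rewrite (negPf nu') in Ps Qt.
have kinj z z' : z != z' -> (k z == k z') = false.
  by move=> zz; rewrite (inj_eq perm_inj) (negPf zz).
have hinj z z' : z != z' -> (h z == h z') = false.
  by move=> zz; rewrite (inj_eq perm_inj) (negPf zz).
(* Otherwise neither contraction of [k] would act at [s], and the two equations would give
   [h u1 = k s = h u2]. *)
have ks : (k s == w1) || (k s == w2).
  apply: contraT; rewrite negb_or => /andP[a1 a2].
  by move: Ps Qs hxy; rewrite !(negPf a1, negPf a2) => -> ->; rewrite eqxx.
have kt : (k t == w1) || (k t == w2).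
  apply: contraT; rewrite negb_or => /andP[a1 a2].
  by move: Pt Qt hxy; rewrite !(negPf a1, negPf a2) => -> ->; rewrite eqxx.
have kst := kinj _ _ st.
have rest z : z != u1 -> z != u2 -> z != s -> z != t -> k z = h z.
  move=> z1 z2 z3 z4; have := PE z; rewrite !ctrE (negPf z1) (negPf z2).
  rewrite -hs (hinj z s) // -ht (hinj z t) // hs ht.
  have [-> ->] // : (k z == w1) = false /\ (k z == w2) = false.
  have := kinj _ _ z3; have := kinj _ _ z4.
  by move: kst; case/orP: ks => /eqP->; case/orP: kt => /eqP->; rewrite ?eqxx.
case/orP: ks => /eqP ks; case/orP: kt => /eqP kt; rewrite ?ks ?kt ?eqxx // in kst.
- left; apply/permP=> z.
  have A1 : (k u1 == w2) = false by rewrite -kt kinj // eq_sym.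
  have A2 : (k u2 == w1) = false by rewrite -ks kinj // eq_sym.
  move: Ps Pt; rewrite ks kt (negPf nw') !eqxx A1 A2 => k1 k2.
  have [->//|z1] := eqVneq z u1; have [->//|z2] := eqVneq z u2.
  have [->|z3] := eqVneq z s; first by rewrite ks hs.
  have [->|z4] := eqVneq z t; first by rewrite kt ht.
  exact: rest.
right; apply/permP=> z.
have A1 : (k u1 == w2) = false by rewrite -ks kinj // eq_sym.
have A2 : (k u2 == w1) = false by rewrite -kt kinj // eq_sym.
move: Ps Pt; rewrite ks kt (negPf nw') !eqxx A1 A2 => k2 k1.
rewrite !permM.
have [->|z1] := eqVneq z u1; first by rewrite tpermL tpermD.
have [->|z2] := eqVneq z u2; first by rewrite tpermR tpermD.
have [->|z3] := eqVneq z s; first by rewrite (@tpermD _ u1 u2 s) 1?eq_sym // tpermL ks ht.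
have [->|z4] := eqVneq z t; first by rewrite (@tpermD _ u1 u2 t) 1?eq_sym // tpermR kt hs.
by rewrite !tpermD 1?eq_sym //; apply: rest.
Qed.

(** Three colors take only two values, so two of them agree and the third differs from them by two
    disjoint swaps. *)
Lemma gap_double_contraction f : ~~ const_fam g -> gap f g 1.
Proof.
move=> ng; have dc := double_contraction.
have [e1 [e0 ne01]] : exists e1 e0, g e1 != g e0.
  move: ng; rewrite negb_forall => /existsP[e1 ne]; by exists e1, ord0.
have hs : h s = w1 by rewrite permKV.
have ht : h t = w2 by rewrite permKV.
have ne z z' : h z != h z' -> z != z' by apply: contra => /eqP->.
have su1 : u1 != s by apply: ne; rewrite hs.
have su2 : u2 != s by apply: ne; rewrite hs.
have tu1 : u1 != t by apply: ne; rewrite ht.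
have tu2 : u2 != t by apply: ne; rewrite ht.
have st : s != t by apply: ne; rewrite hs ht.
set h' := tperm u1 u2 * tperm s t * h in dc *.
have h'E : h = tperm s t * tperm u1 u2 * h'.
  by rewrite /h' !mulgA -(mulgA (tperm s t)) tperm2 mulg1 tperm2 mul1g.
have fin a b c' : a != b -> a != c' -> b != c' -> g b = g c' -> g a != g b -> gap f g 1.
  move=> ab ac bc gbc gab; case: (dc b) => Eb.
    apply: (@gap_two_swaps f g h a b c' u1 u2 s t) => //; rewrite -?gbc //.
      by case: (dc a) => // Ea; rewrite Ea Eb eqxx in gab.
    by rewrite /= !inE !negb_or nu su1 tu1 su2 tu2 st.
  apply: (@gap_two_swaps f g h' a b c' s t u1 u2) => //; rewrite -?gbc //.
    by case: (dc a) => [->//|Ea]; rewrite Ea Eb eqxx in gab.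
  by rewrite /= !inE !negb_or nu st ![s == _]eq_sym ![t == _]eq_sym su1 tu1 su2 tu2.
have n10 : e1 != e0 by apply: contra ne01 => /eqP->.
have [e2 [n12' n02] _] := third n10.
have [E|N] := eqVneq (g e1) (g e2).
  by apply: (fin e0 e1 e2) => //; rewrite eq_sym.
apply: (fin e1 e0 e2) => //.
by case: (dc e0) (dc e1) (dc e2) ne01 N => -> [->|->] [->|->]; rewrite ?eqxx.
Qed.

End DoubleContraction.

(** Induction on the size of [nondip f]. An edge where two colors have [same] can be contracted
    without loss; failing that, a face of length 4 is contracted along one of its two pairs of
    opposite edges. *)
Theorem planar_gap f g : planar_fam f -> gap f g (~~ const_fam g).
Proof.
have [m] := ubnP #|nondip f|; elim: m f g => // m IHm f g lt_m pf.
have [cg|ng] := boolP (const_fam g); first exact: gap_const.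
have [/eqP df|df] := boolP (nondip f == set0); first exact: gap_base.
have lt_ctr k u a : planar_fam k -> nondip k \subset nondip f -> u \in nondip f ->
    nondip (ctrf k u (k a u)) \subset nondip f /\ #|nondip (ctrf k u (k a u))| < m.
  move=> pk sk nu; have sub := nondip_ctr k u a.
  split; first exact: subset_trans sub (subset_trans (subsetDl _ _) sk).
  move: lt_m; rewrite ltnS; apply: leq_trans; apply: proper_card.
  apply: sub_proper_trans (subset_trans sub (setSD _ sk)) _.
  by apply/properP; split; [apply: subsetDl | exists u; rewrite // !inE eqxx].
have IH u a k : u \in nondip f -> gap (ctrf f u (f a u)) k (~~ const_fam k).
  by move=> nu; apply: IHm; [case: (lt_ctr f u a pf (subxx _) nu) | apply: planar_ctr].
have [/existsP[u /existsP[a /andP[nu /forallP gu]]]|noD] :=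
    boolP [exists u, exists a, (u \in nondip f) && [forall c, g c u == f a u]].
  have := IH u a g nu; rewrite (negPf ng); apply: gap_ctr_dip => c; exact/eqP.
have ndip u a : u \in nondip f -> [exists c, g c u != f a u].
  move=> nu; apply: contraNT noD; rewrite negb_exists => /forallP H.
  apply/existsP; exists u; apply/existsP; exists a; rewrite nu.
  by apply/forallP=> c; rewrite -[_ == _]negbK.
have [/existsP[u /existsP[a /andP[nu n2]]]|noS] :=
    boolP [exists u, exists a, (u \in nondip f) && (1 < nsame f g u (f a u))].
  apply: gap_ctr (ndip u a nu) _ (IH u a _ nu).
  by move: n2; case: (~~ _) => /=; lia.
have few u a : u \in nondip f -> nsame f g u (f a u) <= 1.
  move=> nu; rewrite leqNgt; apply: contra noS => n2.
  by apply/existsP; exists u; apply/existsP; exists a; rewrite nu.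
have few2 u a c d : u \in nondip f -> c != d -> f c u = f a u ->
    same (f d) (g d) u (f a u) -> False.
  move=> nu cd fc sd; have := few u a nu; rewrite leqNgt => /negP; apply.
  by apply: nsame_gt1 cd _ sd; apply: same_l.
have [a [b [u1 [u2 [ab nu1 e12 e21]]]]] := short_face pf df.
(* On a face of length 2 both colors would have [same], so the short face has length 4. *)
have nu : u1 != u2.
  apply/eqP=> E; apply: (few2 u1 a a b) => //; apply: same_l; by rewrite e12 E.
have nu' : u2 != u1 by rewrite eq_sym.
have nu2 : u2 \in nondip f.
  by apply: (@nondipI f u2 a b); rewrite -e12 (inj_eq perm_inj).
have [c [ac bc] abc] := third ab.
(* Contract two opposite edges of the face. After the first, both colors of the face join [u2] to
   [w2], so the second gains 1, which pays for the loss of 1 at the first. *)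
have step (a' b' : 'I_3) : a' != b' -> c != a' -> c != b' ->
    f a' u1 = f b' u2 -> f a' u2 = f b' u1 ->
    ~~ const_fam (ctrf (ctrf g u1 (f a' u1)) u2 (f a' u2)) -> gap f g 1.
  move=> ab' ca cb E1 E2; set w1 := f a' u1 in E1 *; set w2 := f a' u2 in E2 *.
  set g1 := ctrf g u1 w1 => ng2; set f1 := ctrf f u1 w1.
  have nw : w1 != w2 by rewrite (inj_eq perm_inj).
  have fa : f1 a' u2 = w2 by rewrite /f1 /ctrf ctr_id.
  have fb : f1 b' u2 = w2.
    by rewrite /f1 /ctrf ctrE (negPf nu') -E1 eqxx -E2.
  have [sub lt] := lt_ctr f u1 a' pf (subxx _) nu1.
  have pf1 : planar_fam f1 by apply: planar_ctr.
  have G2 : gap (ctrf f1 u2 w2) (ctrf g1 u2 w2) 1.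
    have [_ lt2] := lt_ctr f1 u2 a' pf1 sub nu2.
    have := IHm _ (ctrf g1 u2 w2) lt2 (planar_ctr u2 a' pf1).
    by rewrite fa ng2.
  have dip1 : [exists c, g1 c u2 != w2].
    apply/existsP; exists c; rewrite /g1 /ctrf ctrE (negPf nu').
    case: (eqVneq (g c u2) w1) => [gw|_]; apply/eqP=> gw'.
      by apply: (few2 u2 b' b' c) => //; rewrite 1?eq_sym // -E1; apply: same_r.
    by apply: (few2 u2 a' a' c) => //; rewrite 1?eq_sym //; apply: same_r.
  apply: (gap_ctr (n := 2) (ndip u1 a' nu1)).
    have : 0 < nsame f g u1 w1 by apply: (@nsame_gt0 _ _ _ _ a'); apply: same_l.
    by rewrite -/w1; move: (nsame _ _ _ _); clear; lia.
  apply: gap_ctr dip1 _ G2.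
  have : 1 < nsame f1 g1 u2 w2 by apply: (nsame_gt1 ab'); apply: same_l.
  by move: (nsame _ _ _ _); clear; lia.
have [cP|nP] := boolP (const_fam (ctrf (ctrf g u1 (f a u1)) u2 (f a u2))); last first.
  by apply: (step a b) => //; rewrite eq_sym.
have [cQ|nQ] := boolP (const_fam (ctrf (ctrf g u1 (f b u1)) u2 (f b u2))); last first.
  by apply: (step b a) => //; rewrite eq_sym.
(* The side conditions hold because an edge of color [c] of [g] between [u1] or [u2] and a corner of
   the face would give a second color with [same]. *)
apply: (@gap_double_contraction g c u1 u2 (f a u1) (f a u2)) => //.
- by rewrite (inj_eq perm_inj).
- by apply/eqP=> E; apply: (few2 u1 a a c) => //; apply: same_r.
- by apply/eqP=> E; apply: (few2 u1 b b c) => //; apply: same_r; rewrite E.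
- by apply/eqP=> E; apply: (few2 u2 b b c) => //; apply: same_r; rewrite E.
- by apply/eqP=> E; apply: (few2 u2 a a c) => //; apply: same_r.
- by rewrite e21 e12.
Qed.

End Families.

(** * Gluing along a union of cycles *)

Section Glue.
Variables (T : finType) (X : {set T}).
Implicit Types (s t p : {perm T}) (x y : T).

Definition stab s := forall x, (s x \in X) = (x \in X).
Definition off s := forall x, x \notin X -> s x = x.

Lemma stab1 : stab 1. Proof. by move=> x; rewrite perm1. Qed.

Lemma stabV s : stab s -> stab s^-1.
Proof. by move=> sX x; rewrite -sX permKV. Qed.

Lemma stabM s t : stab s -> stab t -> stab (s * t).
Proof. by move=> sX tX x; rewrite permM tX sX. Qed.

Lemma off_stab s : off s -> stab s.
Proof.
move=> os x; have [Xx|nXx] := boolP (x \in X); last by rewrite os // (negPf nXx).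
apply: contraTT Xx => nX; have := os _ nX => /perm_inj E.
by rewrite -E.
Qed.

Lemma stab_agree s t : stab t -> {in X, s =1 t} -> stab s.
Proof.
move=> tX st x; have [Xx|] := boolP (x \in X); first by rewrite st // tX.
apply: contraNF => sx; have Xz : t^-1 (s x) \in X by rewrite (stabV tX).
suff <- : t^-1 (s x) = x by [].
by apply: (@perm_inj _ s); rewrite (st _ Xz) permKV.
Qed.

Lemma agreeV s t : stab s -> {in X, s =1 t} -> {in X, s^-1 =1 t^-1}.
Proof.
move=> sX st x Xx; apply: (@perm_inj _ t); rewrite -st ?permKV //.
by rewrite (stabV sX).
Qed.

Lemma eq_card_porbits p p' : stab p -> {in X, p =1 p'} ->
  #|porbit p @: X| = #|porbit p' @: X|.
Proof.
move=> pX pp'; congr #|pred_of_set _|; apply: eq_in_imset => x Xx.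
have E i : (p ^+ i) x = (p' ^+ i) x /\ (p ^+ i) x \in X.
  elim: i => [|i [IH Xi]]; first by rewrite !expg0 !perm1.
  by rewrite !expgSr !permM -IH pX -pp'.
by apply/setP=> y; apply/porbitP/porbitP => -[i ->]; exists i; case: (E i).
Qed.

Lemma card_porbits_fix p : {in X, forall x, p x = x} -> #|porbit p @: X| = #|X|.
Proof.
move=> pX; apply: card_in_imset => x y Xx Xy /eqP; rewrite eq_porbit_mem => /porbitP[i ->].
by elim: i => [|i]; rewrite ?perm1 // expgSr permM => ->; apply: pX.
Qed.

End Glue.

Lemma sum3_const n : (\sum_(c < 3) n = 3 * n)%N.
Proof. by rewrite sum_nat_const card_ord. Qed.

Section Gluing.
Variables (T : finType).
Implicit Types (X : {set T}) (s t p : {perm T}) (x y : T).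

Lemma stabC X s : stab X s -> stab (~: X) s.
Proof. by move=> sX x; rewrite !inE sX. Qed.

Lemma card_porbits_split X p : stab X p ->
  #|porbits p| = (#|porbit p @: X| + #|porbit p @: ~: X|)%N.
Proof.
move=> pX; have -> : porbits p = porbit p @: X :|: porbit p @: ~: X.
  rewrite -imsetU setUCr; apply/setP=> O.
  by apply/imsetP/imsetP => -[x _ ->]; exists x.
rewrite cardsU; set I := _ :&: _; suff -> : I = set0 by rewrite cards0 subn0.
apply/setP=> O; rewrite !inE; apply/andP=> -[/imsetP[x Xx ->] /imsetP[y]].
rewrite inE => nXy /eqP; rewrite eq_porbit_mem => /porbitP[i E].
move: nXy; have -> : y = (p ^- i) x by rewrite E permK.
suff sV k q : stab X q -> stab X (q ^+ k) by rewrite -expgVn (sV _ _ (stabV pX)) Xx.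
by move=> qX; elim: k => [|k IH]; rewrite ?expg0 ?expgS; [apply: stab1 | apply: stabM].
Qed.

(** The term [#|T|] pays for trivial cycles: [p1] fixes the complement of [X], and [p2] fixes
    [X]. *)
Lemma card_porbits_glue X p p1 p2 : stab X p ->
  {in X, p =1 p1} -> off X p1 -> {in ~: X, p =1 p2} -> off (~: X) p2 ->
  (#|porbits p| + #|T| = #|porbits p1| + #|porbits p2|)%N.
Proof.
move=> pX e1 o1 e2 o2; have o2X := off_stab o2.
have s2 : stab X p2 by have := stabC o2X; rewrite setCK.
rewrite (card_porbits_split pX) (card_porbits_split (off_stab o1)) (card_porbits_split s2).
rewrite -(eq_card_porbits pX e1) -(eq_card_porbits (stabC pX) e2).
rewrite (card_porbits_fix (p := p1)) ?(card_porbits_fix (p := p2)); last 2 first.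
- by move=> x Xx; apply: o2; rewrite !inE negbK.
- by move=> x; rewrite inE => /o1.
by have := cardsC X; lia.
Qed.

Definition glue X s t : {perm T} := restr_perm X s * restr_perm (~: X) t.

Lemma glueE X s t x : stab X s -> stab X t ->
  glue X s t x = if x \in X then s x else t x.
Proof.
move=> sX tX; have Ns : s \in 'N(X | 'P) by apply/astabsP=> y; apply: sX.
have Nt : t \in 'N(~: X | 'P) by apply/astabsP=> y; rewrite /= !inE; congr negb; apply: tX.
rewrite permM; case: ifP => Xx.
  by rewrite (restr_permE Ns Xx) (out_perm (restr_perm_on (~: X) t)) // inE sX Xx.
by rewrite (out_perm (restr_perm_on X s)) ?Xx // (restr_permE Nt) // inE Xx.
Qed.

Lemma stab_glue X s t : stab X s -> stab X t -> stab X (glue X s t).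
Proof. by move=> sX tX x; rewrite glueE //; case: ifP => Xx; rewrite ?sX ?tX. Qed.

Lemma glue_off X s : stab X s -> off X (glue X s 1).
Proof.
by move=> sX x nX; rewrite glueE //; [rewrite (negPf nX) perm1 | apply: stab1].
Qed.

Lemma glue_in X s t : stab X s -> stab X t -> {in X, glue X s t =1 s}.
Proof. by move=> sX tX x Xx; rewrite glueE // Xx. Qed.

Lemma glue_out X s t : stab X s -> stab X t -> {in ~: X, glue X s t =1 t}.
Proof. by move=> sX tX x; rewrite inE glueE // => /negPf->. Qed.

Lemma nclass_isolated (e : rel T) (Y : {set T}) : symmetric e ->
  (forall x y, x \in Y -> e x y -> y = x) ->
  nclass e = (#|root e @: ~: Y| + #|Y|)%N.
Proof.
move=> es iso; rewrite /nclass -(setUCr Y) setUC imsetU cardsU.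
have iso' x y : x \in Y -> connect e x y -> y = x.
  by move=> Yx; apply: connect_isolated => z; apply: iso.
set I := _ :&: _; have -> : I = set0.
  apply/setP=> r; rewrite !inE; apply/andP=> -[/imsetP[x nYx ->] /imsetP[y Yy]].
  move/(connect_root_eq _ _ es); rewrite (sym_connect_sym es) => /(iso' _ _ Yy) E.
  by rewrite E inE Yy in nYx.
rewrite cards0 subn0; congr addn; apply: card_in_imset => x y Yx Yy.
by move/(connect_root_eq _ _ es)/(iso' _ _ Yx).
Qed.

End Gluing.

(** * Surgery on a maximal graph along a planar bubble *)

Section MaximalGluing.
Variables (T : finType) (X F : {set T}) (x0 : T).
Variables (gam : 'I_3 -> {perm T}) (om : {perm T}).
Hypotheses (gamX : forall c, stab X (gam c)).
Hypotheses (omF : {in F, forall x, om x = x}).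
Hypotheses (FX : F \subset ~: X) (Xx0 : x0 \in X).
Hypothesis gam_conn : {in X &, forall x y, connect (meet (fam gam)) x y}.
Hypothesis om_conn : forall x, x \notin F ->
  exists2 y, y \in X & connect (meet (om :: fam gam)) x y.
(** Maximality extended to disconnected competitors, at a price of 3 per extra component. In the
    application [F] is the set of black vertices, which are isolated; hence 1 + [#|F|]. *)
Hypothesis om_max : forall om' : {perm T}, {in F, forall x, om' x = x} ->
  (score1 gam om' + 3 * (1 + #|F|) <= score1 gam om + 3 * ncomp (om' :: fam gam))%N.

Implicit Types (p q s t : {perm T}) (c d : 'I_3).

(** The bubble alone, with three parallel edges at every point outside it. *)
Definition inner c : {perm T} := glue X (gam c) 1.
Local Notation b := inner.

(** The exterior closed by [p]: the bubble is replaced by three parallel edges along each pair of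
    [p]. *)
Definition closing p c : {perm T} := glue X p (gam c).

Lemma innerE c : {in X, b c =1 gam c}. Proof. by apply: glue_in => //; apply: stab1. Qed.

Lemma closing_in p c : stab X p -> {in X, closing p c =1 p}.
Proof. by move=> pX; apply: glue_in. Qed.

Lemma closing_out p c : stab X p -> {in ~: X, closing p c =1 gam c}.
Proof. by move=> pX; apply: glue_out. Qed.

Lemma closing_stab p c : stab X p -> stab X (closing p c).
Proof. by move=> pX; apply: stab_glue. Qed.

Lemma closing_conn p x : off X p -> x \notin F ->
  exists2 y, y \in X & connect (meet (om :: fam (closing p))) x y.
Proof.
move=> /off_stab pX /om_conn[y Xy /connectP[w pw ey]].
elim: w x pw ey => [|z w IH] x /=; first by move=> _ <-; exists y; rewrite ?connect0.
move=> /andP[xz pw] ey; have [z' Xz' zz'] := IH z pw ey.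
have [Xx|nXx] := boolP (x \in X); first by exists x; rewrite ?connect0.
have step z1 : meet (om :: fam (closing p)) x z1 -> z1 \in X \/ z1 = z ->
    exists2 y, y \in X & connect (meet (om :: fam (closing p))) x y.
  move=> xz1 [Xz1|E]; first by exists z1; rewrite ?connect1.
  by exists z' => //; apply: connect_trans zz'; apply: connect1; rewrite -E.
have mem c : closing p c \in om :: fam (closing p) by rewrite inE mem_fam orbT.
have memo : om \in om :: fam (closing p) by rewrite inE eqxx.
have out c u : u \notin X -> closing p c u = gam c u by move=> nX; apply: closing_out; rewrite ?inE.
case/meetP: xz => s [t []]; rewrite !inE => /orP[/eqP->|/famP[c ->]] /orP[/eqP->|/famP[d ->]] E.
- by apply: (step z); [apply/meetP; exists om, om | right].
- have [Xz|nXz] := boolP (z \in X).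
    (* The path enters the bubble at the black vertex [gam d z], which is now reached from [u]. *)
    pose u := p^-1 (gam d z).
    have Xu : u \in X by rewrite (stabV pX) gamX.
    by apply: (step u); [apply/meetP; exists om, (closing p d); rewrite closing_in // permKV | left].
  by apply: (step z); [apply/meetP; exists om, (closing p d); rewrite out | right].
- by apply: (step z); [apply/meetP; exists (closing p c), om; rewrite out | right].
- have nXz : z \notin X by rewrite -(gamX d) -E gamX.
  by apply: (step z); [apply/meetP; exists (closing p c), (closing p d); rewrite !out | right].
Qed.

(** [om_max] is applied to [om1], which closes the bubble by [p] and follows, outside, [om]
    contracted along the pairs of [q]. Cycles and components add up over the two pieces. *)
Lemma closing_bound p q : off X p -> off X q ->
  (score1 b p + score1 (closing q) om + 3 * #|F| <=
   score1 gam om + 3 * ncomp (om :: fam (closing q)) + 3 * #|~: X|)%N.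
Proof.
move=> op oq; have pX := off_stab op; have qX := off_stab oq.
have [om0 [n [om0E om0c om0n om0R]]] := ctr_on X q om.
have om0X : stab X om0 by apply: stab_agree om0E.
have om0F : {in F, forall x, om0 x = x}.
  (* [R] contains [om] and, on [X], also [q], so it still contains the contracted [om0], which
     therefore fixes [F]. *)
  pose R x y := x = y \/ x \notin F /\ y \notin F.
  have : difunctional R.
    by move=> x x' y y' [->|[? ?]] [E|[? ?]] [E'|[? ?]]; subst; try (by left); right.
  have Ro y : R y (om y).
    have [Fy|nFy] := boolP (y \in F); first by left; rewrite omF.
    right; split=> //; apply: contra nFy => Fo; suff <- : om y = y by [].
    by apply: (@perm_inj _ om); rewrite omF.
  have Rq y : y \in X -> R y (q y).
    have nF z : z \in X -> z \notin F.
      by move=> Xz; apply/negP=> /(subsetP FX); rewrite inE Xz.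
    by move=> Xy; right; split; apply: nF; rewrite ?qX.
  by move/om0R/(_ Ro Rq) => H x Fx; case: (H x) => [//|[]]; rewrite Fx.
pose om1 : {perm T} := glue X p om0.
have om1F : {in F, forall x, om1 x = x}.
  by move=> x Fx; rewrite glue_out ?om0F // (subsetP FX).
have cE c : (cyc (gam c) om1 + #|T| = cyc (b c) p + (cyc (closing q c) om + n))%N.
  rewrite -om0c; last by apply: closing_in.
  have bX : stab X (b c) by apply: stab_glue => //; apply: stab1.
  apply: (@card_porbits_glue _ X).
  - by apply: stabM => //; apply: stabV; apply: stab_glue.
  - move=> x Xx; rewrite [LHS]permM [RHS]permM innerE //.
    by apply: (agreeV (stab_glue pX om0X) (glue_in pX om0X)); rewrite gamX.
  - move=> x nX; rewrite [LHS]permM glue_off //; apply: (@perm_inj _ p); rewrite permKV op //.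
  - move=> x nX; rewrite [LHS]permM [RHS]permM closing_out //.
    by apply: (agreeV (stabC (stab_glue pX om0X)) (glue_out pX om0X)); rewrite stabC.
  - move=> x; rewrite inE negbK => Xx; rewrite [LHS]permM closing_in //.
    by rewrite -om0E // permK.
have := om_max om1F; have := om0n (fam (closing q)).
have sE : (score1 gam om1 + 3 * #|T| = score1 b p + score1 (closing q) om + 3 * n)%N.
  rewrite -!sum3_const.
  by rewrite /score1 -!big_split; apply: eq_bigr => c _ /=; rewrite cE addnA.
(* The bubble is the single component of [x0], whereas the points of [X] are isolated for
   [om0 :: fam (closing q)]. *)
suff : (ncomp (om1 :: fam gam) + #|X| <= 1 + ncomp (om0 :: fam (closing q)))%N.
  move: sE; have := cardsC X; clear; lia.
set e1 := meet (om0 :: fam (closing q)); set e2 := meet (om1 :: fam gam).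
have e1s : symmetric e1 by apply: meet_sym.
have e2s : symmetric e2 by apply: meet_sym.
have onX s x : s \in om0 :: fam (closing q) -> x \in X -> s x = q x.
  by rewrite inE => /orP[/eqP->|/famP[c ->]] Xx; [apply: om0E | apply: closing_in].
have stb s : s \in om0 :: fam (closing q) -> stab X s.
  by rewrite inE => /orP[/eqP->|/famP[c ->]] //; apply: closing_stab.
have iso x y : x \in X -> e1 x y -> y = x.
  move=> Xx /meetP[s [t [ls lt E]]].
  have Xy : y \in X by rewrite -(stb t) // -E (stb s).
  by apply/esym/(@perm_inj _ q); rewrite -(onX s) // -(onX t).
rewrite {2}/ncomp (nclass_isolated e1s iso) addnA leq_add2r.
apply: (@leq_trans (1 + #|root e2 @: ~: X|)).
  apply: (@leq_trans #|root e2 x0 |: root e2 @: ~: X|).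
    apply: subset_leq_card; apply/subsetP=> _ /imsetP[x _ ->]; rewrite in_setU1.
    have [Xx|nXx] := boolP (x \in X); last by rewrite imset_f ?orbT // inE.
    apply/orP; left; apply/eqP/(connect_root_eq _ _ e2s).
    apply: connect_sub (gam_conn Xx Xx0) => u v /meetP[s [t [ls lt E]]].
    by apply: connect1; apply/meetP; exists s, t; rewrite !inE ls lt !orbT.
  by rewrite cardsU1 leq_add2r leq_b1.
rewrite leq_add2l; apply: leq_card_roots => // x y _ _; apply: connect_sub => u v e1uv.
have [Xu|nXu] := boolP (u \in X); first by rewrite (iso _ _ Xu e1uv).
case/meetP: e1uv => s [t [ls lt E]].
have nXv : v \notin X by rewrite -(stb t) // -E (stb s).
have H r : r \in om0 :: fam (closing q) -> exists2 r', r' \in om1 :: fam gam &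
    forall z, z \notin X -> r z = r' z.
  rewrite inE => /orP[/eqP->|/famP[c ->]].
    by exists om1; rewrite ?inE ?eqxx // => z nX; rewrite glue_out ?inE.
  by exists (gam c); rewrite ?inE ?mem_fam ?orbT // => z nX; rewrite closing_out ?inE.
have [s' ls' Es] := H s ls; have [t' lt' Et] := H t lt.
by apply: connect1; apply/meetP; exists s', t'; rewrite -Es // -Et.
Qed.

(** The planar inequality against [closing_bound] leaves no slack, so the first-return matchings
    [be] coincide. The same bound at their common value [rho] gives maximality and separation. *)
Theorem maximal_gluing : planar_fam b -> exists rho,
  [/\ off X rho,
      forall q, off X q -> score1 b q <= score1 b rho
    & {in X &, forall u v, connect (meet (om :: fam (closing rho))) u v -> u = v}].
Proof.
move=> pb.
(* [planar_gap] supplies arbitrary permutations; contracting them at the pairs [(x, x)] outside [X]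
   makes them [off X] and preserves the inequality. *)
have offP p : exists q, exists n, [/\ off X q,
    forall f : 'I_3 -> {perm T}, (forall c, off X (f c)) -> score1 f q = (score1 f p + 3 * n)%N
  & forall l, ncomp (q :: l) <= ncomp (p :: l) + n].
  have [q [n [q1 qc qn _]]] := ctr_on (~: X) 1 p; exists q, n; split=> //.
    by move=> x nX; rewrite q1 ?inE // perm1.
  move=> f of1; rewrite /score1 -sum3_const -big_split; apply: eq_bigr => c _ /=; apply: qc => x.
  by rewrite inE perm1; apply: of1.
have offb c : off X (b c) by apply: glue_off.
(* Contracting [om] along [gam c] outside [X] leaves on [X] the first-return matching through the
   exterior; the number counts the cycles gained. *)
have /fin_all_exists[omc omcP] (c : 'I_3) : exists u : {perm T} * nat,
  [/\ {in ~: X, u.1 =1 gam c},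
      forall g : {perm T}, {in ~: X, g =1 gam c} -> cyc g u.1 = (cyc g om + u.2)%N
    & forall R : T -> T -> Prop, difunctional R -> (forall x, R x (om x)) ->
      (forall x, x \in ~: X -> R x (gam c x)) -> forall x, R x (u.1 x)].
  by have [s [n [s1 s2 _ s3]]] := ctr_on (~: X) (gam c) om; exists (s, n).
pose om1 c := (omc c).1.
have omcX c : stab X (om1 c).
  have [H _ _] := omcP c; have := stabC (stab_agree (stabC (gamX c)) H).
  by rewrite setCK.
pose be c := glue X (om1 c) 1.
have offbe c : off X (be c) by apply: glue_off.
have cycE c g : stab X g -> {in ~: X, g =1 gam c} ->
    (cyc g om + (omc c).2)%N = cyc (glue X g 1) (be c).
  move=> gX gE; have [om1E H _] := omcP c; rewrite -H // /cyc.
  congr #|porbits _|; apply/permP=> x; rewrite [LHS]permM [RHS]permM.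
  have [Xx|nX] := boolP (x \in X).
    rewrite (glue_in gX (@stab1 _ _)) //.
    by apply/esym; apply: (agreeV (stab_glue (omcX c) (@stab1 _ _)) (glue_in (omcX c) (@stab1 _ _))); rewrite gX.
  rewrite glue_off // gE ?inE // -om1E ?inE // permK.
  by apply: (@perm_inj _ (be c)); rewrite permKV offbe.
pose N := (\sum_(c < 3) (omc c).2)%N.
have gamE : (score1 gam om + N = score b be)%N.
  by rewrite /score1 -big_split; apply: eq_bigr => c _ /=; rewrite cycE.
have closeE q : off X q -> (score1 (closing q) om + N = score1 be q)%N.
  move=> oq; have qX := off_stab oq; rewrite /score1 -big_split; apply: eq_bigr => c _ /=.
  rewrite cycE; [|exact: closing_stab|exact: closing_out].
  rewrite cycC; congr cyc; apply/permP=> x.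
  rewrite glueE; [|exact: closing_stab|exact: stab1].
  by case: (boolP (x \in X)) => [Xx|nX]; rewrite ?closing_in // perm1 oq.
have [p0 [q0 gap0]] := planar_gap be pb.
have [p [np [op sp _]]] := offP p0; have [q [nq [oq sq nqc]]] := offP q0.
have qX := off_stab oq.
have cE : (ncomp (om :: fam (closing q)) + #|~: X| <= ncomp (q :: fam be) + #|F|)%N.
  (* Points outside [X] are isolated for [e1], while every component of [e] meets [X] or [F]. *)
  set e := meet (om :: fam (closing q)); set e1 := meet (q :: fam be).
  have es : symmetric e by apply: meet_sym.
  have e1s : symmetric e1 by apply: meet_sym.
  have offl s : s \in q :: fam be -> off X s.
    by rewrite inE => /orP[/eqP->|/famP[c ->]].
  have iso x y : x \in ~: X -> e1 x y -> y = x.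
    rewrite inE => nX /meetP[s [t [ls lt E]]].
    have nXy : y \notin X by rewrite -(off_stab (offl t lt)) -E (off_stab (offl s ls)).
    by move: E; rewrite !offl.
  rewrite {2}/ncomp (nclass_isolated e1s iso) setCK -addnA [(#|~: X| + _)%N]addnC addnA leq_add2r.
  apply: (@leq_trans (#|root e @: X| + #|root e @: F|)); last first.
    apply: leq_add; last exact: leq_imset_card.
    apply: leq_card_roots => // x y _ _; apply: connect_sub => u v e1uv.
    have [Xu|nXu] := boolP (u \in X); last by rewrite (iso u v) ?inE // connect0.
    have H s z : s \in q :: fam be -> z \in X -> reach (om :: fam (closing q)) z (s z).
      rewrite inE => /orP[/eqP->|/famP[c ->]] Xz.
        by rewrite -(closing_in ord0 qX) //; apply: reach1; rewrite inE mem_fam orbT.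
      have [_ _ HR] := omcP c; rewrite glue_in //; last exact: stab1.
      apply: (HR (reach (om :: fam (closing q)))) => [|y0|y0 Y0]; first exact: reach_difunctional.
        by apply: reach1; rewrite inE eqxx.
      by rewrite -(closing_out c qX) //; apply: reach1; rewrite inE mem_fam orbT.
    case/meetP: e1uv => s [t [ls lt E]].
    have Xv : v \in X by rewrite -(off_stab (offl t lt)) -E (off_stab (offl s ls)).
    by apply: reach_connect (H s u ls Xu) _; rewrite E; apply: H.
  rewrite /ncomp /nclass; apply: leq_trans (subset_leq_card _) (leq_card_setU _ _).
  apply/subsetP=> _ /imsetP[x _ ->]; rewrite inE.
  have [Fx|nF] := boolP (x \in F); first by rewrite orbC imset_f.
  have [y Xy /(connect_root_eq _ _ es)->] := closing_conn oq nF.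
  by rewrite imset_f.
(* A nonconstant [be] would make the gap strict, against [closing_bound]. *)
have cb : const_fam be.
  have := closing_bound op oq; have := closeE q oq; have := sp _ offb; have := sq _ offbe.
  have := nqc (fam be); move: gamE cE gap0; case: (const_fam be) => //=.
  by rewrite /N; clear; lia.
pose rho := be ord0.
have orho : off X rho by apply: offbe.
have rhoE c : be c = rho by apply/const_famP.
have sr : score b be = score1 b rho by apply: eq_bigr => c _; rewrite rhoE.
have sr' : score1 be rho = (3 * #|T|)%N.
  rewrite /score1 (eq_bigr (fun=> #|T|)) ?sum_nat_const ?card_ord // => c _.
  by rewrite rhoE cycss.
have bound s : off X s -> (score1 b s + 3 * #|X| + 3 * #|F| <=
    score1 b rho + 3 * ncomp (om :: fam (closing rho)))%N.
  move=> os; have := closing_bound os orho; have := closeE rho orho.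
  have := cardsC X; move: gamE; rewrite sr sr'; clear; lia.
have cover (A : {set T}) :
    (forall x, x \in X -> exists2 y, y \in A & connect (meet (om :: fam (closing rho))) x y) ->
    ncomp (om :: fam (closing rho)) <= #|A| + #|F|.
  move=> HA; apply: leq_trans (leq_card_setU A F).
  apply: nclass_le_card (@meet_sym _ _) _ => x.
  have [Fx|nF] := boolP (x \in F); first by exists x; rewrite ?inE ?Fx ?orbT.
  have [y Xy xy] := closing_conn orho nF; have [z Az yz] := HA y Xy.
  by exists z; rewrite ?inE ?Az //; apply: connect_trans yz.
exists rho; split=> // [s os|u v Xu Xv uv].
  have := bound s os; have : ncomp (om :: fam (closing rho)) <= #|X| + #|F|.
    by apply: cover => x Xx; exists x.
  by clear; lia.
(* [bound] at [rho] forces at least [#|X|] + [#|F|] components, which is too many if [u] and [v]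
   share one. *)
apply/eqP; apply: contraT => nuv.
have := bound rho orho; have := cardsD1 v X; rewrite Xv.
have : ncomp (om :: fam (closing rho)) <= #|X :\ v| + #|F|.
  apply: cover => x Xx; have [->|nxv] := eqVneq x v.
    by exists u; rewrite ?inE ?nuv // connect_meetC.
  by exists x; rewrite ?inE ?nxv.
by clear; lia.
Qed.

End MaximalGluing.

(** * Reconnecting a disconnected graph *)

Section Reconnect.
Variables (T : finType) (F : {set T}) (x0 : T) (gam : 'I_3 -> {perm T}) (c0 : 'I_3).
Hypotheses (nFx0 : x0 \notin F) (gam1 : gam c0 = 1).
Hypothesis gamF : forall c, {in F, forall x, gam c x = x}.

Let step om x : reach (om :: fam gam) x (om x).
Proof. by apply: reach1; rewrite inE eqxx. Qed.

Let next om x : connect (meet (om :: fam gam)) x (om x).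
Proof.
apply: connect1; apply/meetP; exists om, 1; rewrite perm1 -gam1.
by rewrite !inE eqxx mem_fam orbT.
Qed.

(* As [gam c0 = 1], the cycles of [om] lie in components, so that swapping two
   targets joins the cycles of [x] and [y]. *)
Lemma ncomp_swap om x y : ~~ connect (meet (om :: fam gam)) x y ->
  ncomp (tperm x y * om :: fam gam) < ncomp (om :: fam gam).
Proof.
set e := meet _ => nxy; set om' := tperm x y * om; set e' := meet (om' :: fam gam).
have P u w : ~~ connect e u w -> om' u = om w -> (forall z, z != u -> z != w -> om' z = om z) ->
    connect e' u w.
  move=> nuw uw rest.
  (* The [om]-cycle of [w] stays in the component of [w] and so avoids [u]; [om'] enters it from [u]
     and follows it back to [w]. *)
  have Q i : connect e w ((om ^+ i.+1) w) /\ connect e' u ((om ^+ i.+1) w).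
    elim: i => [|i [IH1 IH2]]; first by rewrite expg1 -{2}uw; split; apply: next.
    rewrite expgSr permM; set z := (om ^+ i.+1) w in IH1 IH2 *.
    split; first exact: connect_trans IH1 (next _ _).
    have [->|nzw] := eqVneq z w; first by rewrite -uw; apply: next.
    have nzu : z != u by apply: contraNneq nuw => <-; rewrite connect_meetC.
    by rewrite -rest //; apply: connect_trans IH2 (next _ _).
  by have [_] := Q #[om].-1; rewrite prednK ?order_gt0 // expg_order perm1.
have xy : connect e' x y.
  by apply: P; rewrite ?permM ?tpermL // => z zx zy; rewrite permM tpermD // eq_sym.
apply: (nclass_lt (@meet_sym _ _) (@meet_sym _ _) _ xy nxy).
apply: meet_sub => s z; rewrite inE => /orP[/eqP->|/famP[c ->]]; last first.
  by apply: reach1; rewrite inE mem_fam orbT.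
have := step om' (tperm x y z); rewrite permM tpermK; apply: connect_reach.
by apply: connect_tperm => //; apply: meet_sym.
Qed.

(** Each swap joins two components outside [F] and costs at most one cycle in each of three colors.
    At the end one component remains besides the isolated points of [F]. *)
Lemma reconnect (om : {perm T}) : {in F, forall x, om x = x} -> exists om' : {perm T},
  [/\ {in F, forall x, om' x = x},
      {in ~: F &, forall x y, connect (meet (om' :: fam gam)) x y}
    & (score1 gam om + 3 * (1 + #|F|) <= score1 gam om' + 3 * ncomp (om :: fam gam))%N].
Proof.
have [m] := ubnP (ncomp (om :: fam gam)); elim: m om => // m IHm om lt_m omF.
have [/existsP[x /existsP[y /and3P[Fx Fy nxy]]]|conn] :=
  boolP [exists x, exists y, [&& x \notin F, y \notin F & ~~ connect (meet (om :: fam gam)) x y]].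
  have lt := ncomp_swap nxy; have := cyc_tperm om _ x y.
  have [om1 om1E] : {s : {perm T} | s = tperm x y * om} by exists (tperm x y * om).
  rewrite -om1E in lt * => cyc1.
  have [|z Fz|om' [omF' oc le]] := IHm om1.
  - exact: leq_trans lt _.
  - by rewrite om1E permM tpermD ?omF //; [apply: contraNneq Fx => -> | apply: contraNneq Fy => ->].
  exists om'; split=> //; have : score1 gam om <= score1 gam om1 + (3 * 1)%N.
    rewrite -sum3_const /score1 -big_split; apply: leq_sum => c _ /=.
    by rewrite ![cyc (gam c) _]cycC addn1.
  move: lt le; move: (ncomp (om1 :: _)) (ncomp (om :: _)) (score1 gam om1) (score1 gam om).
  by move: (score1 gam om') #|F| => *; lia.
exists om; split=> //.
  move=> x y; rewrite !inE => Fx Fy; apply: contraNT conn => nxy.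
  by apply/existsP; exists x; apply/existsP; exists y; rewrite Fx Fy.
rewrite leq_add2l leq_mul2l /= /ncomp (nclass_isolated (@meet_sym _ _) (Y := F)).
  rewrite leq_add2r card_gt0; apply/set0Pn; exists (root (meet (om :: fam gam)) x0).
  by rewrite imset_f // inE.
move=> x y Fx /meetP[s [t [ls lt E]]].
have fixF r : r \in om :: fam gam -> {in F, forall z, r z = z}.
  by rewrite inE => /orP[/eqP->|/famP[c ->]] //; apply: gamF.
by apply: (@perm_inj _ t); rewrite -E !(fixF s, fixF t).
Qed.

End Reconnect.

(** * Colored graphs as permutations *)

Section Walks.
Variables (n : nat) (G : cgraph n).
Implicit Types (a b c : 'I_n) (x y z : G).

Definition whites : {set G} := [set x | white x].

Lemma nb_inj c : injective (nb G c).
Proof. exact/inv_inj/nbK. Qed.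

Lemma spanP (E : {set 'I_n * G}) x y :
  reflect (exists2 c, edge_at c x \in E & nb G c x = y) (span E x y).
Proof.
apply: (iffP existsP) => [[c /andP[cE /eqP cy]]|[c cE cy]]; exists c => //.
by rewrite cE cy eqxx.
Qed.

Lemma edge_at_edges c x : edge_at c x \in edges G.
Proof. by rewrite inE /=; case: ifP => // wx; rewrite white_nb wx. Qed.

Lemma edge_at_nb c x : edge_at c (nb G c x) = edge_at c x.
Proof. by rewrite /edge_at white_nb; case: (white x) => //=; rewrite nbK. Qed.

Lemma span_sym (E : {set 'I_n * G}) : symmetric (span E).
Proof.
by move=> x y; apply/spanP/spanP => -[c cE <-]; exists c; rewrite ?edge_at_nb ?nbK.
Qed.

Definition step2 a b x := nb G b (nb G a x).

Lemma step2_inj a b : injective (step2 a b).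
Proof. by move=> x y /nb_inj/nb_inj. Qed.

Definition walk a b : {perm G} := perm (@step2_inj a b).

Lemma walkE a b x : walk a b x = nb G b (nb G a x).
Proof. by rewrite permE. Qed.

(** The white vertices of a bicolored cycle form one orbit of [walk a b], which advances by two
    edges. *)
Lemma bicyclesE a b : bicycles G a b = #|porbit (walk a b) @: whites|.
Proof.
rewrite /bicycles; set e := span _.
have es : symmetric e by apply: span_sym.
have E c x : c \in [set a; b] -> e x (nb G c x).
  by move=> cab; apply/spanP; exists c; rewrite // inE edge_at_edges.
have Ea x : e x (nb G a x) by apply: E; rewrite !inE eqxx.
have Eb x : e x (nb G b x) by apply: E; rewrite !inE eqxx orbT.
rewrite (n_comp_imset_root (A := whites) (sym_connect_sym es)) => [|x]; last first.
  have [wx|bx] := boolP (white x); first by exists x; rewrite ?inE.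
  by exists (nb G a x); rewrite ?inE ?white_nb ?bx // connect1.
apply: eq_card_imset_ker => x y; rewrite !inE => wx wy.
rewrite (connect_root_eq _ _ es); split; last first.
  move/eqP; rewrite eq_porbit_mem porbit_sym => /porbitP[i ->].
  elim: i => [|i IH]; first by rewrite expg0 perm1.
  rewrite expgSr permM walkE; apply: connect_trans IH _.
  by apply: connect_trans (connect1 (Ea _)) (connect1 (Eb _)).
have pw z : porbit (walk a b) (nb G b (nb G a z)) = porbit (walk a b) z.
  by have := porbit_perm (walk a b) 1 z; rewrite expg1 walkE.
pose w z := if white z then z else nb G a z.
suff H z z' : e z z' -> porbit (walk a b) (w z) = porbit (walk a b) (w z').
  move=> /connectP[q pq yq]; suff : porbit (walk a b) (w x) = porbit (walk a b) (w y).
    by rewrite /w wx wy.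
  rewrite yq {wx wy yq}; elim: q x pq => [//|z q IH x] /= /andP[/H-> pq]; exact: IH.
move=> /spanP[c]; rewrite !inE /= => /andP[_ /orP[/eqP->|/eqP->]] <-.
  by rewrite /w white_nb; case: (white z); rewrite /= ?nbK.
rewrite /w white_nb; case: (white z) => /=; last by rewrite -[LHS]pw nbK.
by rewrite -[RHS]pw !nbK.
Qed.

End Walks.

Section Relabelling.
Variable G : cgraph 4.
Implicit Types (x y z : G) (c : 'I_3) (a b : 'I_4) (s t : {perm G}).

Definition ref := nb G (lift ord0 ord0).

Lemma refK : involutive ref. Proof. exact: nbK. Qed.
Lemma white_ref x : white (ref x) = ~~ white x. Proof. exact: white_nb. Qed.

Definition relabel (f : G -> G) x := if white x then ref (f x) else x.

Lemma relabel_inj a : injective (relabel (nb G a)).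
Proof.
move=> x y; rewrite /relabel.
case: ifP => wx; case: ifP => wy // E.
- exact: nb_inj (inv_inj refK E).
- by move: wy; rewrite -E white_ref white_nb wx.
- by move: wx; rewrite E white_ref white_nb wy.
Qed.

(* The edges of color [a], as a permutation of the white vertices: black
   vertices are identified with white ones along the edges of color 1. *)
Definition colp a : {perm G} := perm (@relabel_inj a).

Lemma colpE a x : colp a x = if white x then ref (nb G a x) else x.
Proof. by rewrite permE. Qed.

Definition gamma c := colp (lift ord0 c).
Definition omega := colp ord0.
Definition blacks : {set G} := [set x | ~~ white x].

Lemma colp_black a : {in blacks, forall x, colp a x = x}.
Proof. by move=> x; rewrite inE colpE => /negPf->. Qed.

Lemma white_colp a x : white (colp a x) = white x.
Proof. by rewrite colpE; case: ifP => // wx; rewrite white_ref white_nb wx. Qed.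

Lemma gamma0 : gamma ord0 = 1.
Proof. by apply/permP=> x; rewrite colpE perm1; case: ifP => //; rewrite refK. Qed.

Lemma colp_walk a b : {in whites G, colp a * (colp b)^-1 =1 walk G a b}.
Proof.
move=> x; rewrite inE => wx; rewrite permM walkE.
apply: (@perm_inj _ (colp b)); rewrite permKV !colpE wx !white_nb wx /=.
by rewrite nbK.
Qed.

(** Every [colp] fixes the black vertices, and each of them counts as a trivial cycle. *)
Lemma cyc_colp a b : cyc (colp a) (colp b) = (bicycles G a b + #|blacks|)%N.
Proof.
have bw : blacks = ~: whites G by apply/setP=> x; rewrite !inE.
have wst a' : stab (whites G) (colp a') by move=> x; rewrite !inE white_colp.
have pst : stab (whites G) (colp a * (colp b)^-1) by apply: stabM => //; apply: stabV.
rewrite /cyc (card_porbits_split pst) bicyclesE bw; congr addn.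
  by apply: eq_card_porbits => //; apply: colp_walk.
apply: card_porbits_fix => x; rewrite -bw => bx; rewrite permM colp_black //.
by apply: (@perm_inj _ (colp b)); rewrite permKV colp_black.
Qed.

Lemma score1_omega : score1 gamma omega = (C0 G + 3 * #|blacks|)%N.
Proof.
rewrite /score1 /C0 -sum3_const -big_split; apply: eq_bigr => c _ /=.
by rewrite cycC cyc_colp.
Qed.

Section Connectivity.
Variables (A : {set 'I_4}) (l : seq {perm G}) (E : {set 'I_4 * G}).
Hypotheses (lA : forall s, reflect (exists2 a, a \in A & s = colp a) (s \in l)).
Hypothesis EA : forall a x, (edge_at a x \in E) = (a \in A).

Lemma connect_meet_span x y : white x -> connect (meet l) x y -> connect (span E) x y.
Proof.
move=> wx /connectP[p]; elim: p x wx => [x _ _ ->//|z p IH x wx] /= /andP[/meetP[s [t [ls lt st]]] pz] yl.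
have [a Aa sa] := lA s ls; have [b Ab tb] := lA t lt.
have wz : white z by rewrite -(white_colp b) -tb -st sa white_colp.
apply: connect_trans (IH z wz pz yl); move: st; rewrite sa tb !colpE wx wz => /(inv_inj refK) E1.
apply: (@connect_trans _ _ (nb G a x)); apply: connect1; apply/spanP.
  by exists a; rewrite ?EA.
by exists b; rewrite ?EA // E1 nbK.
Qed.

(** A black end is recorded as [ref y], because [colp] names black vertices by their white neighbor
    of color 1. *)
Lemma connect_span_meet x y : white x -> connect (span E) x y ->
  if white y then connect (meet l) x y else reach l x (ref y).
Proof.
move=> wx; suff H p z : path (span E) z p -> 
    (if white z then connect (meet l) x z else reach l x (ref z)) ->
    if white (last z p) then connect (meet l) x (last z p) else reach l x (ref (last z p)).
  by move=> /connectP[p pp ->]; apply: H pp _; rewrite wx connect0.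
elim: p z => [//|z' p IH z] /= /andP[/spanP[a]]; rewrite EA => Aa <- pz xz.
apply: (IH _ pz); have la : colp a \in l by apply/lA; exists a.
rewrite white_nb; case: ifP xz => /= wz xz.
  by apply: connect_reach xz _; have := reach1 z la; rewrite colpE wz.
apply: reach_connect xz _; have := reach1 (nb G a z) la.
by rewrite colpE white_nb wz /= nbK.
Qed.

End Connectivity.

Definition all_colors := omega :: fam gamma.

Lemma all_colorsP s : reflect (exists2 a, a \in [set: 'I_4] & s = colp a) (s \in all_colors).
Proof.
rewrite inE; apply: (iffP orP) => [[/eqP->|/famP[c ->]]|[a _ ->]].
- by exists ord0.
- by exists (lift ord0 c).
case: (unliftP ord0 a) => [c|] ->; last by left.
by right; apply: mem_fam.
Qed.

End Relabelling.

Section Connected.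
Variable G : cgraph 4.

Lemma gconnected_whites : gconnected G ->
  {in ~: blacks G &, forall x y, connect (meet (omega G :: fam (gamma G))) x y}.
Proof.
move=> /andP[_ /forallP cG] x y; rewrite !inE !negbK => wx wy.
have /forallP/(_ y) cxy := cG x.
have EA a z : (edge_at a z \in edges G) = (a \in [set: 'I_4]) by rewrite edge_at_edges inE.
have := connect_span_meet (@all_colorsP G) EA wx cxy; by rewrite wy.
Qed.

Lemma whites_gconnected : 0 < #|G| ->
  {in ~: blacks G &, forall x y, connect (meet (omega G :: fam (gamma G))) x y} -> gconnected G.
Proof.
move=> G0 cW; rewrite /gconnected /connected_by G0; apply/forallP=> x; apply/forallP=> y.
have EA a z : (edge_at a z \in edges G) = (a \in [set: 'I_4]) by rewrite edge_at_edges inE.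
have sC : connect_sym (span (edges G)) by apply/sym_connect_sym/span_sym.
have W z : exists2 w, white w & connect (span (edges G)) z w.
  have [wz|bz] := boolP (white z); first by exists z; rewrite ?connect0.
  exists (ref z); first by rewrite white_ref.
  by apply: connect1; apply/spanP; exists (lift ord0 ord0); rewrite ?edge_at_edges.
have [wx wwx cx] := W x; have [wy wwy cy] := W y.
apply: (connect_trans cx); rewrite sC; apply: (connect_trans cy); rewrite sC.
apply: (connect_meet_span (@all_colorsP G) EA wwx).
by apply: cW; rewrite !inE negbK.
Qed.

Lemma bubble_relP (x y : G) :
  reflect (exists c : 'I_3, nb G (lift ord0 c) x = y) (bubble_rel x y).
Proof.
apply: (iffP (spanP _ _ _)) => [[a]|[c <-]]; last first.
  by exists (lift ord0 c) => //; rewrite in_set edge_at_edges.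
rewrite in_set edge_at_edges /=; case: (unliftP ord0 a) => [c ->|->] // _ <-.
by exists c.
Qed.

End Connected.

Lemma iso_trans (n : nat) (G H K : cgraph n) : iso G H -> iso H K -> iso G K.
Proof.
move=> [f [bf wf nf]] [g [bg wg ng]]; exists (g \o f); split=> [|v|c v] /=.
- exact: bij_comp.
- by rewrite wg wf.
- by rewrite nf ng.
Qed.

(** * Replacing the edges of color 0 *)

Section Regraph.
Variables (G : cgraph 4) (om : {perm G}).
Hypothesis omF : {in blacks G, forall x, om x = x}.

Lemma white_fix x : white (om x) = white x.
Proof.
have [wx|bx] := boolP (white x); last by rewrite omF ?inE // (negPf bx).
apply: contraTT wx => nw; have := omF (x := om x).
by rewrite inE => /(_ nw)/perm_inj <-.
Qed.

Lemma white_fixV x : white (om^-1 x) = white x.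
Proof. by rewrite -white_fix permKV. Qed.

Definition renb (a : 'I_4) (x : G) : G :=
  if unlift ord0 a is Some c then nb G (lift ord0 c) x
  else if white x then ref (om x) else om^-1 (ref x).

Lemma renbK a : involutive (renb a).
Proof.
rewrite /renb; case: unliftP => [c _|_] x; first exact: nbK.
case: (boolP (white x)) => wx.
  by rewrite white_ref white_fix wx /= refK permK.
by rewrite white_fixV white_ref wx permKV refK.
Qed.

Lemma white_renb a x : white (renb a x) = ~~ white x.
Proof.
rewrite /renb; case: unliftP => [c _|_]; first exact: white_nb.
by case: ifP => wx; rewrite ?white_ref ?white_fix ?white_fixV ?white_ref wx.
Qed.

Definition regraph : cgraph 4 := @CGraph 4 G (@white 4 G) renb renbK white_renb.

Lemma nb_regraph c (x : G) : nb regraph (lift ord0 c) x = nb G (lift ord0 c) x.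
Proof. by rewrite /= /renb liftK. Qed.

Lemma gamma_regraph c : gamma regraph c = gamma G c :> {perm G}.
Proof.
apply/permP=> x; apply: etrans (@colpE regraph (lift ord0 c) x) _.
by rewrite colpE /ref !nb_regraph.
Qed.

Lemma omega_regraph : omega regraph = om :> {perm G}.
Proof.
apply/permP=> x; apply: etrans (@colpE regraph ord0 x) _.
rewrite /ref nb_regraph; case: ifP => [wx|/negbT bx].
  by rewrite /= /renb unlift_none; case: ifP (wx) => // _ _; rewrite -/(ref _) refK.
by rewrite omF // inE.
Qed.

Lemma bubble_rel_regraph : @bubble_rel regraph =2 @bubble_rel G.
Proof.
by move=> x y; apply/bubble_relP/bubble_relP => -[c <-]; exists c; rewrite nb_regraph.
Qed.

Lemma bubble_set_regraph (x : G) : @bubble_set regraph x = bubble_set x.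
Proof.
by apply/setP=> y; rewrite !inE; apply: eq_connect; apply: bubble_rel_regraph.
Qed.

Lemma iso_bubble_regraph (x : G) : iso (@bubble_at regraph x) (bubble_at x).
Proof.
have fP (u : @bubble_at regraph x) : (val u : G) \in bubble_set x.
  by rewrite -bubble_set_regraph (valP u).
have gP (u : bubble_at x) : val u \in @bubble_set regraph x.
  by rewrite bubble_set_regraph (valP u).
exists (fun u => exist _ (val u : G) (fP u)); split=> // [|c u].
  by exists (fun u => exist _ (val u) (gP u)) => u; apply: val_inj.
by apply: val_inj; rewrite /= -nb_regraph.
Qed.

Lemma in_G_regraph N (B : 'I_N -> cgraph 3) m :
  in_G B m G -> gconnected regraph -> in_G B m regraph.
Proof.
move=> [_ [t [isoB cardB]]] cR; split=> //; exists t; split=> [x|j].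
  rewrite bubble_set_regraph.
  by apply: iso_trans (isoB x); apply: iso_bubble_regraph.
rewrite -cardB; congr #|pred_of_set _|; apply/setP=> S; rewrite !inE; congr andb.
by apply/imsetP/imsetP => -[x _ ->]; exists x; rewrite // bubble_set_regraph.
Qed.

Lemma C0_regraph : score1 (gamma G) om = (C0 regraph + 3 * #|blacks G|)%N.
Proof.
rewrite -(score1_omega regraph); apply: eq_bigr => c _.
by rewrite omega_regraph gamma_regraph.
Qed.

End Regraph.

(** Reconnecting [om] costs at most 3 per extra component and yields a competitor of [G] with the
    same bubbles. *)
Lemma Gmax_score N (B : 'I_N -> cgraph 3) m (G : cgraph 4) (x0 : G) (om : {perm G}) :
  in_Gmax B m G -> white x0 -> {in blacks G, forall x, om x = x} ->
  (score1 (gamma G) om + 3 * (1 + #|blacks G|) <=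
   score1 (gamma G) (omega G) + 3 * ncomp (om :: fam (gamma G)))%N.
Proof.
move=> [inG maxG] wx0 omF.
have nF : x0 \notin blacks G by rewrite inE negbK.
have gF c : {in blacks G, forall x, gamma G c x = x} by apply: colp_black.
have [om' [omF' conn le]] := reconnect nF (gamma0 G) gF omF.
apply: leq_trans le _; rewrite leq_add2r (C0_regraph omF') score1_omega leq_add2r.
apply: maxG; apply: in_G_regraph inG _; apply: whites_gconnected.
  by apply/card_gt0P; exists x0.
move=> x y bx bY; rewrite -(@eq_connect _ (meet (om' :: fam (gamma G)))); first exact: conn.
apply: eq_meet => s; rewrite !inE omega_regraph; congr orb.
by apply/famP/famP => -[c ->]; exists c; rewrite gamma_regraph.
Qed.

(** * Faces of planar bubbles *)

Lemma fcard_imset_root (T : finType) (f : T -> T) (A : {set T}) : injective f ->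
  (forall x, exists2 y, y \in A & fconnect f x y) ->
  fcard f predT = #|froot f @: A|.
Proof. by move=> fI; apply: n_comp_imset_root; apply: fconnect_sym. Qed.

Lemma fcard_bij (T U : finType) (f : T -> T) (g : U -> U) (h : T -> U) :
  injective f -> injective g -> bijective h -> (forall x, h (f x) = g (h x)) ->
  fcard f predT = fcard g predT.
Proof.
move=> fI gI [k hK kK] hfg.
have H x y : fconnect f x y <-> fconnect g (h x) (h y).
  have hi i z : h (iter i f z) = iter i g (h z) by elim: i => //= i <-.
  split=> [/iter_findex <-|/iter_findex]; first by rewrite hi fconnect_iter.
  by rewrite -hi => /(can_inj hK) <-; apply: fconnect_iter.
rewrite (fcard_imset_root (A := setT) fI) => [|x]; last by exists x.
rewrite (fcard_imset_root (A := h @: setT) gI) => [|x]; last first.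
  by exists x; rewrite ?connect0 //; apply/imsetP; exists (k x); rewrite ?kK.
rewrite -imset_comp; apply: eq_card_imset_ker => x y _ _ /=.
by split=> /(rootP (fconnect_sym _)) => c; apply/(rootP (fconnect_sym _)) => //; apply/H; apply: c.
Qed.

Section Faces.
Variable B : cgraph 3.

Lemma map_node_inj : injective (@map_node B).
Proof.
move=> [x c] [y d]; rewrite /map_node /= => -[xy]; rewrite xy.
by case: ifP => _; [move/ordS_inj-> | move/ord_pred_inj->].
Qed.

Lemma map_edgeK : involutive (@map_edge B).
Proof. by case=> x c; rewrite /map_edge /= nbK. Qed.

Lemma map_face_inj : injective (@map_face B).
Proof. exact: inj_comp map_node_inj (inv_inj map_edgeK). Qed.

Lemma card_blacks : #|[set x : B | ~~ white x]| = #|whites B|.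
Proof.
rewrite -(card_imset (whites B) (@nb_inj _ B ord0)); apply: eq_card => x.
rewrite inE; apply/idP/imsetP => [bx|[y]]; last by rewrite inE => wy ->; rewrite white_nb wy.
by exists (nb B ord0 x); rewrite ?nbK // inE white_nb.
Qed.

Lemma leq_fcard_node : fcard (@map_node B) predT <= #|whites B|.*2.
Proof.
have -> : #|whites B|.*2 = #|B|.
  rewrite -(cardsC (whites B)) -addnn; congr addn; rewrite -card_blacks.
  by apply: eq_card => x; rewrite !inE.
rewrite (fcard_imset_root (A := [set d : B * 'I_3 | d.2 == ord0]) map_node_inj).
  apply: leq_trans (leq_imset_card _ _) _.
  rewrite -cardsT -(card_imset setT (f := fun x : B => (x, ord0 : 'I_3))) => [|x y [] //].
  apply: subset_leq_card; apply/subsetP=> -[x c]; rewrite inE /= => /eqP->.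
  by apply/imsetP; exists x.
move=> [x c]; exists (x, ord0); first by rewrite inE.
suff [k <-] : exists k, iter k (@map_node B) (x, c) = (x, ord0) by apply: fconnect_iter.
have [wx|bx] := boolP (white x).
- exists (3 - c); case: c => [[|[|[|]]] //= ?]; rewrite /map_node /= ?wx;
    by congr pair; apply: val_inj.
- exists (c : nat); case: c => [[|[|[|]]] //= ?]; rewrite /map_node /= ?(negPf bx);
    by congr pair; apply: val_inj.
Qed.

Let wdarts := [set d : B * 'I_3 | white d.1].

Lemma card_wdarts : #|wdarts| = (3 * #|whites B|)%N.
Proof.
have -> : wdarts = setX (whites B) [set: 'I_3] by apply/setP=> d; rewrite !inE andbT.
by rewrite cardsX cardsT card_ord mulnC.
Qed.

Lemma geq_fcard_edge : (3 * #|whites B|)%N <= fcard (@map_edge B) predT.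
Proof.
rewrite (fcard_imset_root (A := wdarts) (inv_inj map_edgeK)) => [|[x c]]; last first.
  have [wx|bx] := boolP (white x); first by exists (x, c); rewrite ?inE.
  exists (map_edge (x, c)); last exact: fconnect1.
  by rewrite inE /= white_nb.
rewrite card_in_imset ?card_wdarts // => d e; rewrite !inE => wd we.
move/(rootP (fconnect_sym (inv_inj map_edgeK))) => /iter_findex Ee.
have [E|E] : e = d \/ e = map_edge d; last 2 first.
- by [].
- by move: we; rewrite E /= white_nb wd.
rewrite -Ee; elim: (findex _ _ _) => [|k [IH|IH]] /=; first by left.
  by right; rewrite IH.
by left; rewrite IH map_edgeK.
Qed.

(** Every face contains a white dart, and two steps of [map_face] from a white dart [(x, c)] lead to
    [(walk B c (ord_pred c) x, c)]. *)
Lemma leq_fcard_face : fcard (@map_face B) predT <=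
  \sum_(c < 3) #|porbit (walk B c (ord_pred c)) @: whites B|.
Proof.
have fC := fconnect_sym map_face_inj.
rewrite (fcard_imset_root (A := wdarts) map_face_inj) => [|[x c]]; last first.
  have [wx|bx] := boolP (white x); first by exists (x, c); rewrite ?inE.
  exists (map_face (x, c)); last exact: fconnect1.
  by rewrite inE /= white_nb.
pose R (c : 'I_3) := (fun x : B => froot (@map_face B) (x, c)) @: whites B.
have RE c : #|R c| <= #|porbit (walk B c (ord_pred c)) @: whites B|.
  apply: leq_card_imset_ker => x y; rewrite !inE => wx wy.
  move/eqP; rewrite eq_porbit_mem porbit_sym => /porbitP[i ->].
  suff [wi ci] : white ((walk B c (ord_pred c) ^+ i) x) /\
      fconnect (@map_face B) (x, c) ((walk B c (ord_pred c) ^+ i) x, c).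
    by apply/(rootP fC).
  elim: i => [|i [wi ci]]; first by rewrite expg0 perm1.
  rewrite expgSr permM; set z := (walk B c (ord_pred c) ^+ i) x in wi ci *; rewrite walkE !white_nb wi.
  split=> //; apply: connect_trans ci _; suff -> : (nb B (ord_pred c) (nb B c z), c) =
      iter 2 (@map_face B) (z, c) by apply: fconnect_iter.
  by rewrite /map_face /map_node /map_edge /= !white_nb wi /= ord_predK.
apply: (@leq_trans #|R ord0 :|: R (lift ord0 ord0) :|: R ord_max|).
  apply: subset_leq_card; apply/subsetP=> _ /imsetP[[x c] wx ->].
  rewrite inE /= in wx; have xR : froot (@map_face B) (x, c) \in R c.
    by apply/imsetP; exists x; rewrite // inE.
  have /orP[/eqP E|/orP[/eqP E|/eqP E]] : (c == ord0) || ((c == lift ord0 ord0) || (c == ord_max)).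
  - by case: c {xR} => [[|[|[|]]] //= ?].
  - by rewrite -E !inE xR.
  - by rewrite -E !inE xR orbT.
  - by rewrite -E !inE xR !orbT.
rewrite (@sum3 _ ord0 (lift ord0 ord0) ord_max) //.
apply: leq_trans (leq_card_setU _ _) (leq_add _ _) => //.
by apply: leq_trans (leq_card_setU _ _) (leq_add _ _).
Qed.

(** Euler's formula with at most 2w nodes and at least 3w edges, where w is the number of white
    vertices. *)
Lemma planar_faces : planar B ->
  #|whites B| + 2 <= \sum_(c < 3) #|porbit (walk B c (ord_pred c)) @: whites B|.
Proof.
rewrite /planar /has_genus addn0; have := leq_fcard_face; have := geq_fcard_edge.
by have := leq_fcard_node; lia.
Qed.

End Faces.

Lemma iso_planar (B B' : cgraph 3) : iso B B' -> planar B' -> planar B.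
Proof.
move=> [f [bf wf nf]]; rewrite /planar /has_genus.
pose h (d : B * 'I_3) : B' * 'I_3 := (f d.1, d.2).
have bh : bijective h.
  case: bf => k fK kK; exists (fun d => (k d.1, d.2)) => -[x c]; rewrite /h /= ?fK ?kK //.
have hn d : h (map_node d) = map_node (h d) by rewrite /h /map_node /= wf.
have he d : h (map_edge d) = map_edge (h d) by rewrite /h /map_edge /= nf.
rewrite (fcard_bij (@map_node_inj B) (@map_node_inj B') bh hn).
rewrite (fcard_bij (@map_face_inj B) (@map_face_inj B') bh) => [|d]; last by rewrite /map_face hn he.
by rewrite (fcard_bij (inv_inj (@map_edgeK B)) (inv_inj (@map_edgeK B')) bh he).
Qed.

(** * Edge cuts and the theorem *)

Lemma card_porbits_inj (T U : finType) (f : T -> U) (p : {perm T}) (q : {perm U})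
    (W : {set T}) : injective f -> stab W p -> {in W, forall x, f (p x) = q (f x)} ->
  #|porbit p @: W| = #|porbit q @: (f @: W)|.
Proof.
move=> fI pW fpq; rewrite -imset_comp; apply: eq_card_imset_ker => x y Wx Wy /=.
have E i z : z \in W -> f ((p ^+ i) z) = (q ^+ i) (f z) /\ (p ^+ i) z \in W.
  move=> Wz; elim: i => [|i [IH Wi]]; first by rewrite !expg0 !perm1.
  by rewrite !expgSr !permM fpq // IH pW.
split=> /eqP; rewrite !eq_porbit_mem => /porbitP[i]; last first.
  have [<- _] := E i y Wy; move/fI => ->; apply/eqP; rewrite eq_porbit_mem.
  exact: mem_porbit.
by move=> ->; apply/eqP; rewrite eq_porbit_mem; have [-> _] := E i y Wy; apply: mem_porbit.
Qed.

Section NoBridge.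
Variable G : cgraph 4.

(* The two ends of an edge of color 0 are joined by the rest of its bicolored
   cycle of colors 0 and 1. *)
Lemma no_bridge (w : G) : gconnected G -> white w ->
  connected_by (edges G :\ (ord0, w)).
Proof.
move=> /andP[G0 /forallP cG] ww; rewrite /connected_by G0 /=.
set A := edges G :\ _; have sC : connect_sym (span A) by apply/sym_connect_sym/span_sym.
have sp c x : edge_at c x != (ord0, w) -> connect (span A) x (nb G c x).
  by move=> ne; apply: connect1; apply/spanP; exists c; rewrite // in_setD1 ne edge_at_edges.
have sref x : connect (span A) x (ref x) by apply: sp.
have omE x : white x -> omega G x = ref (nb G ord0 x) by move=> wx; rewrite colpE wx.
have W : connect (span A) (nb G ord0 w) w.
  suff Q i : white ((omega G ^+ i.+1) w) /\ connect (span A) (nb G ord0 w) ((omega G ^+ i.+1) w).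
    by have [_] := Q #[omega G].-1; rewrite prednK ?order_gt0 // expg_order perm1.
  elim: i => [|i [wi IH]]; first by rewrite expg1 white_colp omE.
  rewrite expgSr permM; set z := (omega G ^+ i.+1) w in wi IH *; rewrite white_colp; split=> //.
  have [->|nzw] := eqVneq z w; first by rewrite omE.
  apply: connect_trans IH _; rewrite omE //; apply: connect_trans (sref _).
  by apply: sp; rewrite /edge_at wi xpair_eqE eqxx.
apply/forallP=> x; apply/forallP=> y; have /forallP/(_ y) := cG x.
apply: connect_sub => {x y} x y /spanP[c _ <-].
have [E|] := eqVneq (edge_at c x) (ord0, w); last exact: sp.
case: E => -> /=; case: ifP => [_ ->|_ nw]; first by rewrite sC.
by rewrite nw -[X in connect _ X _](nbK ord0) nw.
Qed.

End NoBridge.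

(** * A bubble inside a colored graph: planarity, pairings and cuts *)

Section Bubble.
Variables (G : cgraph 4) (v : G).

Local Notation S := (bubble_set v).
Let X : {set G} := [set x in S | white x].

Lemma bubble_set_nbE c x : (nb G (lift ord0 c) x \in S) = (x \in S).
Proof.
apply/idP/idP => [|Sx]; last exact: bubble_set_nb.
by move/(bubble_set_nb c); rewrite nbK.
Qed.

Lemma bubble_set_ref x : (ref x \in S) = (x \in S).
Proof. exact: bubble_set_nbE. Qed.

Let inX x : (x \in X) = (x \in S) && white x.
Proof. by rewrite in_set. Qed.

Lemma stab_gamma c : stab X (gamma G c).
Proof.
move=> x; rewrite !inX white_colp colpE; congr andb.
by case: ifP => // _; rewrite bubble_set_ref bubble_set_nbE.
Qed.

Lemma val_whites : val @: whites (bubble_at v) = X.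
Proof.
apply/setP=> x; rewrite inX; apply/imsetP/andP => [[u]|[Sx wx]].
  by rewrite inE => wu ->; rewrite (valP u).
by exists (exist _ x Sx); rewrite ?inE.
Qed.

Local Notation b := (inner X (gamma G)).

Lemma inner_off c : off X (b c).
Proof. by apply: glue_off; apply: stab_gamma. Qed.

Lemma cyc_inner c d : cyc (b c) (b d) =
  (#|porbit (walk (bubble_at v) c d) @: whites (bubble_at v)| + #|~: X|)%N.
Proof.
have bX e : stab X (b e) by apply: off_stab; apply: inner_off.
have pX : stab X (b c * (b d)^-1) by apply: stabM => //; apply: stabV.
rewrite /cyc (card_porbits_split pX); congr addn; last first.
  apply: card_porbits_fix => x; rewrite inE => nX; rewrite permM inner_off //.
  by apply: (@perm_inj _ (b d)); rewrite permKV inner_off.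
have wX : stab (whites (bubble_at v)) (walk (bubble_at v) c d).
  by move=> u; rewrite ![_ \in whites _]inE walkE !white_nb negbK.
have vw : {in whites (bubble_at v), forall u,
    val (walk (bubble_at v) c d u) = walk G (lift ord0 c) (lift ord0 d) (val u)}.
  by move=> u _; rewrite !walkE.
rewrite (card_porbits_inj val_inj wX vw) val_whites; apply: eq_card_porbits => // x Xx.
have wx : x \in whites G by move: Xx; rewrite inX [x \in whites G]inE => /andP[].
rewrite -colp_walk // [LHS]permM [RHS]permM innerE //; last exact: stab_gamma.
apply: (agreeV (bX d) (innerE stab_gamma d)).
by rewrite (stab_gamma c).
Qed.

Lemma bubble_connected : {in X &, forall x y, connect (meet (fam (gamma G))) x y}.
Proof.
move=> x y; rewrite !inX => /andP[Sx wx] /andP[Sy wy].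
have sC : connect_sym (@bubble_rel G) by apply/sym_connect_sym/span_sym.
rewrite inE in Sx; rewrite inE in Sy.
have cxy : connect (@bubble_rel G) x y by apply: connect_trans Sy; rewrite sC.
have lA s : reflect (exists2 a, a \in [set~ ord0] & s = colp G a) (s \in fam (gamma G)).
  apply: (iffP (famP _ _)) => [[c ->]|[a]]; first by exists (lift ord0 c); rewrite ?inE.
  by rewrite !inE; case: (unliftP ord0 a) => [c ->|->] // _ ->; exists c.
have EA a z : (edge_at a z \in [set e in edges G | e.1 != ord0]) = (a \in [set~ ord0]).
  by rewrite in_set edge_at_edges !inE.
by have := connect_span_meet lA EA wx cxy; rewrite wy.
Qed.

Lemma white_in_bubble : exists x, x \in X.
Proof.
have Sv : v \in S by rewrite inE connect0.
have [wv|bv] := boolP (white v); first by exists v; rewrite inX Sv.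
by exists (ref v); rewrite inX bubble_set_ref Sv white_ref.
Qed.

Lemma planar_inner : planar (bubble_at v) -> planar_fam b.
Proof.
move=> /planar_faces pl; rewrite /planar_fam /faces.
rewrite (reindex_inj (@ord_pred_inj 3)) /=.
have -> : \sum_(c < 3) cyc (b (ord_pred c)) (b (ordS (ord_pred c))) =
    (\sum_(c < 3) #|porbit (walk (bubble_at v) c (ord_pred c)) @: whites (bubble_at v)| + 3 * #|~: X|)%N.
  rewrite -sum3_const -big_split; apply: eq_bigr => c _ /=.
  by rewrite ord_predK cycC cyc_inner.
have [x0 Xx0] := white_in_bubble.
(* The bubble is connected, so [x0] represents it; each point outside [X] represents itself. *)
have : ncomp (fam b) <= #|x0 |: ~: X|.
  apply: nclass_le_card (@meet_sym _ _) _ => x.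
  have [Xx|nX] := boolP (x \in X); last by exists x; rewrite ?connect0 // in_setU in_setC nX orbT.
  exists x0; first by rewrite in_setU1 eqxx.
  have /connectP[p] := bubble_connected Xx Xx0.
  elim: p x Xx => [x _ _ ->|y p IH x Xx] //= /andP[/meetP[s [t [/famP[c ->] /famP[d ->] E]]] py] ly.
  have Xy : y \in X by rewrite -(stab_gamma d) -E stab_gamma.
  apply: connect_trans (IH y Xy py ly); apply: connect1; apply/meetP; exists (b c), (b d).
  by rewrite !mem_fam !innerE // => e; apply: stab_gamma.
rewrite cardsU1 in_setC Xx0 /= add1n -(cardsC X); move: pl.
have -> : #|whites (bubble_at v)| = #|X| by rewrite -val_whites card_imset //; apply: val_inj.
by move: #|X| #|~: X| (ncomp _) (\sum_(c < 3) _) => p q r s; lia.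
Qed.

(** Turns maximality of a pairing into maximality of [score1] among permutations [off X]; the points
    outside [X] add a constant. *)
Lemma C0_pairing (q : pairing (bubble_at v)) (s : {perm G}) : off X s ->
  (forall u : bubble_at v, white (val u) -> val (q u) = ref (s (val u))) ->
  (C0 (pairing_graph q) + 3 * #|~: X|)%N = score1 b s.
Proof.
move=> os qs; rewrite /C0 -sum3_const -big_split; apply: eq_bigr => c _ /=.
have sX := off_stab os; have bX : stab X (b c) by apply: off_stab; apply: inner_off.
have pX : stab X (s * (b c)^-1) by apply: stabM => //; apply: stabV.
rewrite cycC /cyc (card_porbits_split pX); congr addn; last first.
  apply/esym/card_porbits_fix => x; rewrite inE => nX; rewrite permM os //.
  by apply: (@perm_inj _ (b c)); rewrite permKV inner_off.
rewrite bicyclesE; set wk := walk _ _ _.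
have wX : stab (whites (pairing_graph q)) wk.
  by move=> u; rewrite ![_ \in whites _]inE walkE !white_nb negbK.
suff vw : {in whites (pairing_graph q), forall u, val (wk u) = (s * (b c)^-1) (val u)}.
  by rewrite (card_porbits_inj val_inj wX vw) -val_whites.
move=> u; rewrite inE => wu; rewrite walkE permM.
have -> : val (nb (pairing_graph q) (lift ord0 c) (nb (pairing_graph q) ord0 u)) =
    nb G (lift ord0 c) (ref (s (val u))).
  by rewrite /= /closure_nb liftK unlift_none /= qs.
have Xu : val u \in X by rewrite inX (valP u).
have : s (val u) \in X by rewrite sX.
rewrite inX => /andP[Ssu wsu].
apply: (@perm_inj _ (b c)); rewrite permKV (innerE stab_gamma); last first.
  by rewrite inX bubble_set_nbE bubble_set_ref Ssu white_nb white_ref wsu.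
by rewrite colpE white_nb white_ref wsu /= nbK refK.
Qed.


Section PairingOfPerm.
Variable rho : {perm G}.
Hypothesis rho_off : off X rho.

Let rhoS x : x \in S -> white x -> (rho x \in S) /\ white (rho x).
Proof.
move=> Sx wx; have : rho x \in X by rewrite (off_stab rho_off) inX Sx.
by rewrite inX => /andP.
Qed.

Let rhoVS x : x \in S -> white x -> (rho^-1 x \in S) /\ white (rho^-1 x).
Proof.
move=> Sx wx; have : rho^-1 x \in X by rewrite (stabV (off_stab rho_off)) inX Sx.
by rewrite inX => /andP.
Qed.

Definition match_vertex x := if white x then ref (rho x) else rho^-1 (ref x).

Lemma match_in x : x \in S -> match_vertex x \in S.
Proof.
move=> Sx; rewrite /match_vertex; case: (boolP (white x)) => wx.
  by rewrite bubble_set_ref; case: (rhoS Sx wx).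
by case: (@rhoVS (ref x)); rewrite ?bubble_set_ref ?white_ref.
Qed.

Definition match_fun (u : bubble_at v) : bubble_at v :=
  exist _ (match_vertex (val u)) (match_in (valP u)).

Lemma match_funK : involutive match_fun.
Proof.
move=> u; apply: val_inj; rewrite /= /match_vertex.
case: (boolP (white (val u))) => wu.
  by rewrite white_ref; case: (rhoS (valP u) wu) => _ ->; rewrite /= refK permK.
case: (@rhoVS (ref (val u))); rewrite ?bubble_set_ref ?white_ref ?(valP u) // => _ ->.
by rewrite permKV refK.
Qed.

Lemma white_match u : white (match_fun u) = ~~ white u.
Proof.
rewrite /= /match_vertex; case: (boolP (white (val u))) => wu.
  by rewrite white_ref; case: (rhoS (valP u) wu) => _ ->.
by case: (@rhoVS (ref (val u))); rewrite ?bubble_set_ref ?white_ref ?(valP u) // => _ ->.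
Qed.

Definition perm_pairing : pairing (bubble_at v) := Pairing match_funK white_match.

Lemma val_perm_pairing u : white (val u) -> val (perm_pairing u) = ref (rho (val u)).
Proof. by move=> wu; rewrite /= /match_vertex wu. Qed.

End PairingOfPerm.

Lemma pairing_perm (q : pairing (bubble_at v)) : exists2 s : {perm G}, off X s &
  forall u : bubble_at v, white (val u) -> val (q u) = ref (s (val u)).
Proof.
pose f x := if insub x is Some u then if white x then ref (val (q u)) else x else x.
have fE (u : bubble_at v) : white (val u) -> f (val u) = ref (val (q u)).
  by move=> wu; rewrite /f valK wu.
have fX x : x \in X -> exists u : bubble_at v, x = val u /\ white (val u).
  by rewrite inX => /andP[Sx wx]; exists (exist _ x Sx).
have fn x : x \notin X -> f x = x.
  rewrite inX /f; case: insubP => [u Su ux|//]; case: ifP => // wx.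
  by rewrite Su.
have fin x : x \in X -> f x \in X.
  move=> /fX[u [-> wu]]; rewrite fE // inX bubble_set_ref (valP (q u)) white_ref.
  by rewrite -[white (val (q u))]/(white (q u)) white_pfun negbK.
have fI : injective f.
  move=> x y E; have [Xx|nX] := boolP (x \in X); have [Xy|nY] := boolP (y \in X).
  - have [u [xu wu]] := fX x Xx; have [w [yw ww]] := fX y Xy.
    move: E; rewrite xu yw !fE // => /(inv_inj (@refK G))/val_inj/(inv_inj (@pfunK _ q)) -> //.
  - by move: (fin x Xx); rewrite E (fn y nY) (negPf nY).
  - by move: (fin y Xy); rewrite -E (fn x nX) (negPf nX).
  - by move: E; rewrite !fn.
exists (perm fI) => [x nX|u wu]; rewrite permE; first exact: fn.
by rewrite fE // refK.
Qed.

(* The exterior edges at [x] and at its partner [y] bound a whole component of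
   the exterior, which the partner edge closes up. *)
Lemma cut_of_component (rho : {perm G}) x :
  gconnected G -> off X rho ->
  {in X &, forall u w, connect (meet (omega G :: fam (closing X (gamma G) rho))) u w -> u = w} ->
  x \in X -> let y := ref (rho x) in
  nb G ord0 x = y \/
  edge_cut 2 [set edge_at ord0 x; edge_at ord0 y] /\
  incident_on [set edge_at ord0 x; edge_at ord0 y] S.
Proof.
move=> cG orho sep Xx y; have [E|nxy] := eqVneq (nb G ord0 x) y; [by left | right].
have rX := off_stab orho; set l := omega G :: _ in sep.
have Xr : rho x \in X by rewrite rX.
have /andP[Sx wx] : (x \in S) && white x by rewrite -inX.
have /andP[Sr wr] : (rho x \in S) && white (rho x) by rewrite -inX.
have Sy : y \in S by rewrite bubble_set_ref.
have wy : white y = false by rewrite white_ref wr.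
have lo : omega G \in l by rewrite inE eqxx.
have lc c : closing X (gamma G) rho c \in l by rewrite inE mem_fam orbT.
have cin c z : z \in X -> closing X (gamma G) rho c z = rho z.
  exact: (closing_in stab_gamma c rX).
have cout c z : z \notin X -> closing X (gamma G) rho c z = gamma G c z.
  by move=> nX; apply: (closing_out stab_gamma c rX); rewrite in_setC.
have omE z : white z -> omega G z = ref (nb G ord0 z) by move=> wz; rewrite colpE wz.
have rE z : z \in X -> reach l z (rho z).
  by move=> Xz; rewrite -(cin ord0) //; apply: reach1.
have black_end z : z \in S -> ~~ white z -> exists2 z', z' \in X & rho z' = ref z.
  move=> Sz bz; exists (rho^-1 (ref z)); last by rewrite permKV.
  by rewrite (stabV rX) inX bubble_set_ref white_ref Sz.
(* If the edge of color 0 at [x] ended in the bubble, its end would be matched by [rho] to some [z']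
   in the component of [x], and [sep] would give [z' = x]. *)
have nSx : nb G ord0 x \notin S.
  apply: contra nxy => Sn; have [|z' Xz' rz'] := black_end _ Sn; first by rewrite white_nb wx.
  have E : x = z'.
    apply: sep => //; apply: reach_connect (rE _ Xz').
    by rewrite rz' -omE //; apply: reach1.
  by rewrite /y (_ : rho x = ref (nb G ord0 x)) ?refK // -rz' -E.
have nSy : nb G ord0 y \notin S.
  apply: contra nxy => Sn; have wn : white (nb G ord0 y) by rewrite white_nb wy.
  have Xn : nb G ord0 y \in X by rewrite inX Sn.
  have -> : x = nb G ord0 y; last by rewrite nbK.
  apply: sep => //; apply: reach_connect (rE x Xx) _.
  by have := reach1 (nb G ord0 y) lo; rewrite omE // nbK refK.
have ex : edge_at ord0 x = (ord0, x) by rewrite /edge_at wx.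
have ey : edge_at ord0 y = (ord0, nb G ord0 y) by rewrite /edge_at wy.
have nexy : edge_at ord0 x != edge_at ord0 y.
  rewrite ex ey xpair_eqE eqxx /=; apply: contraNneq nSy => <-; exact: Sx.
set F := [set _; _]; split; last first.
  move=> e; rewrite in_set2 => /orP[/eqP->|/eqP->]; rewrite ?ex ?ey /=; split=> //.
    by rewrite Sx (negPf nSx).
  by rewrite nbK Sy (negPf nSy).
split.
- by apply/subsetP=> e; rewrite in_set2 => /orP[/eqP->|/eqP->]; apply: edge_at_edges.
- by rewrite cards2 nexy.
(* [D] is the component of [x] without the bubble. Edges outside [F] never leave it, so it separates
   [nb G ord0 x] from [x]. *)
- pose D z := (z \notin S) && (if white z then connect (meet l) x z else reach l x (ref z)).
  have D0 : D (nb G ord0 x).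
    by rewrite /D nSx white_nb wx -omE //; apply: reach1.
  apply/negP=> /andP[_ /forallP/(_ (nb G ord0 x))/forallP/(_ x)/connectP[p]].
  elim: p (nb G ord0 x) D0 => [z Dz _ /= E|z' p IH z Dz] /=.
    by move: Dz; rewrite /D -E Sx.
  move=> /andP[/spanP[a]]; rewrite in_setD => /andP[nF _] <- pz.
  apply: (IH _ _ pz); case/andP: Dz => nSz Dz.
  case: (unliftP ord0 a) nF => [c -> _|-> nF].
    rewrite /D bubble_set_nbE nSz white_nb; case: ifP Dz => /= wz Dz.
      apply: connect_reach Dz _; have := reach1 z (lc c).
      by rewrite cout ?colpE ?wz // inX negb_and nSz.
    apply: reach_connect Dz _; have := reach1 (nb G (lift ord0 c) z) (lc c).
    by rewrite cout ?colpE ?white_nb ?wz /= ?nbK // inX negb_and bubble_set_nbE nSz.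
  rewrite /D white_nb; case: ifP Dz => /= wz Dz.
    have Rn : reach l x (ref (nb G ord0 z)).
      by apply: connect_reach Dz _; rewrite -omE //; apply: reach1.
    rewrite Rn andbT; apply: contra nF => Sn.
    have [|z1 Xz1 rz1] := black_end _ Sn; first by rewrite white_nb wz.
    have E : x = z1 by apply: sep => //; apply: reach_connect (rE _ Xz1); rewrite rz1.
    rewrite in_set2; apply/orP; right; rewrite -edge_at_nb.
    by rewrite /y E rz1 refK.
  have Cn : connect (meet l) x (nb G ord0 z).
    apply: reach_connect Dz _; have := reach1 (nb G ord0 z) lo.
    by rewrite omE ?white_nb ?wz // nbK.
  rewrite Cn andbT; apply: contra nF => Sn.
  have E : x = nb G ord0 z by apply: sep => //; rewrite inX Sn white_nb wz.
  by rewrite in_set2 -edge_at_nb -E eqxx.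
(* A proper subset of [F] contains at most one edge, and no single edge of color 0 is a bridge. *)
move=> F' /properP[sF [e Fe nF'e]].
suff [w ww sub] : exists2 w, white w & edges G :\ (ord0, w) \subset edges G :\: F'.
  have /andP[G0 /forallP cw] := no_bridge cG ww.
  rewrite /connected_by G0; apply/forallP=> x1; apply/forallP=> y1.
  have /forallP/(_ y1) := cw x1; apply: connect_sub => z z' /spanP[c Ec cz].
  by apply: connect1; apply/spanP; exists c => //; apply: (subsetP sub).
have other w e' : e' = (ord0, w) -> F :\ e \subset [set e'] -> edges G :\ (ord0, w) \subset edges G :\: F'.
  move=> <- sub; apply: setDS; apply: subset_trans sub.
  by apply/subsetP=> e1 Fe1; rewrite in_setD1 (subsetP sF) // andbT; apply: contraNneq nF'e => <-.
move: Fe; rewrite in_set2 => /orP[/eqP Ee|/eqP Ee].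
  exists (nb G ord0 y); first by rewrite white_nb wy.
  apply: (other _ _ ey); apply/subsetP=> e1; rewrite in_setD1 in_set2 in_set1 Ee.
  by case: eqP.
exists x => //; apply: (other _ _ ex); apply/subsetP=> e1; rewrite in_setD1 in_set2 in_set1 Ee.
by rewrite orbC; case: eqP.
Qed.

End Bubble.

Theorem theorem4 (N : nat) (B : 'I_N -> cgraph 3) (n : 'I_N -> nat)
    (hB : forall j, is_bubble (B j)) (hn : forall j, 0 < n j)
    (i : 'I_N) (hi : planar (B i))
    (G : cgraph 4) (hG : in_Gmax B n G)
    (v : G) (hv : iso (bubble_at v) (B i)) :
  maximal_2cut v.
Proof.
have cG : gconnected G by case: hG => [[]].
have pl := planar_inner (iso_planar hv hi).
have [x0 Xx0] := white_in_bubble v.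
pose X := [set x in bubble_set v | white x].
have /andP[_ wx0] : (x0 \in bubble_set v) && white x0 by move: Xx0; rewrite in_set.
have FX : blacks G \subset ~: X.
  by apply/subsetP=> x; rewrite inE in_setC in_set negb_and orbC => ->.
have oconn x : x \notin blacks G ->
    exists2 y, y \in X & connect (meet (omega G :: fam (gamma G))) x y.
  move=> nx; exists x0 => //; apply: gconnected_whites => //; first by rewrite in_setC.
  by rewrite !inE negbK.
have [rho [orho maxr sep]] := maximal_gluing (@stab_gamma G v) (@colp_black G ord0) FX Xx0
  (@bubble_connected G v) oconn (fun om => @Gmax_score N B n G x0 om hG wx0) pl.
exists (perm_pairing orho); split=> [q|u].
  have [s os sq] := pairing_perm q.
  have := maxr s os; have <- := C0_pairing orho (val_perm_pairing orho).
  by have <- := C0_pairing os sq; rewrite leq_add2r.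
have cut := cut_of_component cG orho sep.
have [wu|bu] := boolP (white (val u)).
  rewrite val_perm_pairing //; apply: cut.
  by rewrite in_set wu andbT; apply: (valP u).
(* A black [u] is handled through its white partner, which exchanges the two edges. *)
set p := perm_pairing orho; have pu : val u = ref (rho (val (p u))).
  by rewrite -val_perm_pairing ?pfunK // -[white _]/(white (p u)) white_pfun.
have Xp : val (p u) \in X.
  by rewrite in_set (valP (p u)) -[white _]/(white (p u)) white_pfun.
have := cut _ Xp; rewrite -pu => -[E|C]; [left | right].
  by rewrite -E nbK.
by rewrite setUC.
Qed.
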